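(* Let $f$ be a map as described in the context. There exists a finite-to-one and onto Hölder continuous semi-conjugacy $\Theta$ between the two dynamical systems $(\Sigma_3,\sigma)$ (the full shift on three symbols) and $(\Lambda,f)$; that is, a finite-to-one, surjective, Hölder continuous map $\Theta:\Sigma_3\to\Lambda$ with $\Theta\circ\sigma=f\circ\Theta$.
   Context: **The map $f$.** Let $\mathcal Q=[0,1]\times[0,1]$, $0<\lambda<1/3$, $\sigma>3$, $c>0$ (the real parameter $\sigma$ is used only in this description of $f$; elsewhere $\sigma$ is the shift). $f:\mathcal Q\to\mathbb R^2$ is a one-to-one map of class $C^2$ (extending to a diffeomorphism of $\mathbb R^2$ with non-wandering set contained in $\mathcal Q$) such that, with $R_i'=f(R_i)$: (a) $f(x,y)=(\lambda x,\sigma y)$ on $R_1=\{0\le y\le\sigma^{-1}\}$; (b) $f(x,y)=(\lambda x+(1-\lambda),\sigma y-(\sigma-1))$ on $R_5=\{1-\tfrac23\sigma^{-1}\le y\le 1\}$; (c) there is a horizontal strip $R_3\subset[0,1]\times[1/3,1]$ mapped affinely, with derivative $\mathrm{diag}(-\lambda,-\sigma)$, onto a vertical strip parallel to $R_5'$; (d) points of $\mathcal Q$ between $R_1$ and $R_3$ (region $R_2$) are mapped outside $\mathcal Q$; (e) between $R_3$ and $R_5$ there is a region $R_4$ bounded by two disjoint curves of the form $\{y=\psi(x):x\in[0,1]\}$ such that: (i) the top and bottom sides of $R_4$ are mapped into $R_2$, outside $f(R_1)$; (ii) $f(\{x=0\}\cap R_4)$ is contained in the graph of $x\mapsto c(x-q)^2$,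 where $q\in(2/3,1)$, with $\|\partial f/\partial y(0,y)\|\ge\sigma$ there, and this image does not meet the right side of $\mathcal Q$; (iii) for every $x_0\in[0,1]$, $f(\{x=x_0\}\cap R_4)$ is contained in the graph of $x\mapsto c(x-q)^2-\lambda x_0$, $\langle\partial f/\partial y,\partial f/\partial x\rangle=0$ on $R_4$, and $\|\partial f/\partial x(f^{-1}(q,0))\|=\lambda$; (f) points between $R_3$ and $R_5$ outside $R_4$ are mapped into $R_2$ with second coordinate greater than $\sigma^{-1}$. Moreover $f|_{R_4}=\Psi\circ\Gamma$ with $\Gamma(x,y)=(\lambda x,\sigma(y-t))$ and $\Psi$ independent of $\lambda,\sigma$. The point $(0,0)$ is a fixed saddle and $Q=(q,0)$, with preimage $T=(0,t)$, is a point of homoclinic tangency of its invariant manifolds. Standing assumptions on parameters: $c$ is fixed sufficiently large and then $\lambda$ and $\sigma^{-1}$ are sufficiently small (depending on $c$), with $2\sqrt{c(\lambda+\sigma^{-1})}<\arctan(\pi/10)$ and $0<b^{-1}<-\ln\lambda/\ln\sigma<b$ for some fixed $b>0$. **Definitions.** $\Lambda=\bigcap_{n\in\mathbb Z}f^n(\mathcal Q)$ is the set of points whose whole orbit stays in $\mathcal Q$, with the Euclidean metric. $\Sigma_3=\{0,1,2\}^{\mathbb Z}$ is the space of bi-infinite sequences of three symbols, $\sigma$ is the shift on it, and the distance between two distinct sequences $\xi,\xi'$ is $2^{-n}$, where $n$ is the largest non-negative integer with $\xi_k=\xi'_k$ for all $-n\le k\le n$ (the usual product metric). *)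

(* Defs.v *)
(* MathComp-Analysis; the plane is R * R for an abstract R : realType. *)
From HB Require Import structures.
From mathcomp Require Import all_boot all_order all_algebra.
From mathcomp Require Import all_classical all_reals all_analysis.

Set Implicit Arguments.
Unset Strict Implicit.
Unset Printing Implicit Defensive.

Import Order.TTheory GRing.Theory Num.Theory numFieldNormedType.Exports.

Local Open Scope classical_set_scope.
Local Open Scope ring_scope.

(* The library norm on R * R is the max norm, hence a separate definition. *)
Definition enorm {R : realType} (p : R * R) : R :=
  Num.sqrt (p.1 ^+ 2 + p.2 ^+ 2).

Definition dot {R : realType} (p p' : R * R) : R := p.1 * p'.1 + p.2 * p'.2.

Definition ddx {R : realType} {V : normedModType R} (g : R * R -> V)
  (p : R * R) : V := 'D_((1, 0) : R * R) g p.

Definition ddy {R : realType} {V : normedModType R} (g : R * R -> V)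
  (p : R * R) : V := 'D_((0, 1) : R * R) g p.

Definition C1_fun {R : realType} (g : R * R -> R) : Prop :=
  [/\ forall p, derivable g p ((1, 0) : R * R),
      forall p, derivable g p ((0, 1) : R * R),
      continuous (ddx g : R * R -> R) & continuous (ddy g : R * R -> R)].

Definition C2_fun {R : realType} (g : R * R -> R) : Prop :=
  [/\ C1_fun g, C1_fun (ddx g) & C1_fun (ddy g)].

Definition C2_map {R : realType} (f : R * R -> R * R) : Prop :=
  C2_fun (fun p => (f p).1) /\ C2_fun (fun p => (f p).2).

Definition C2_diffeo {R : realType} (f : R * R -> R * R) : Prop :=
  C2_map f /\ exists g : R * R -> R * R, [/\ C2_map g, cancel f g & cancel g f].

Definition nonwandering {R : realType} (f : R * R -> R * R) : set (R * R) :=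
  [set p | forall U : set (R * R), nbhs p U ->
     exists n : nat, (0 < n)%N /\ (iter n f @` U) `&` U !=set0].

Definition square {R : realType} : set (R * R) := `[0, 1] `*` `[0, 1].

Definition R1 {R : realType} (sig : R) : set (R * R) :=
  [set p | square p /\ p.2 <= sig^-1].

(* b3 and t3 are the heights of the bottom and top sides of R3. *)
Definition R2 {R : realType} (sig b3 : R) : set (R * R) :=
  [set p | square p /\ sig^-1 < p.2 < b3].

Definition R3 {R : realType} (b3 t3 : R) : set (R * R) :=
  [set p | square p /\ b3 <= p.2 <= t3].

Definition R4 {R : realType} (psi1 psi2 : R -> R) : set (R * R) :=
  [set p | square p /\ psi1 p.1 <= p.2 <= psi2 p.1].

Definition bot5 {R : realType} (sig : R) : R := 1 - 2 / 3 * sig^-1.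

Definition R5 {R : realType} (sig : R) : set (R * R) :=
  [set p | square p /\ bot5 sig <= p.2].

(* The map is given by its extension f to a diffeomorphism of the plane: all
   conditions other than hs_diffeo and hs_nonwandering concern f on the square
   only.  They force (0, 0) to be a saddle fixed point whose invariant manifolds
   contain the two axes near (0, 0), so that (q, 0) is a homoclinic tangency. *)
Record horseshoe {R : realType} (lam sig c q t b3 t3 : R) (psi1 psi2 : R -> R)
    (Psi f : R * R -> R * R) : Prop := Horseshoe {
  hs_lam : 0 < lam < 1 / 3;
  hs_sig : 3 < sig;
  hs_c : 0 < c;
  hs_q : 2 / 3 < q < 1;
  hs_diffeo : C2_diffeo f;
  hs_nonwandering : nonwandering f `<=` square;
  hs_R1 : forall x y, R1 sig (x, y) -> f (x, y) = (lam * x, sig * y);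
  hs_R5 : forall x y, R5 sig (x, y) ->
    f (x, y) = (lam * x + (1 - lam), sig * y - (sig - 1));
  hs_strip3 : 1 / 3 <= b3 /\ b3 < t3 <= 1;
  (* with such a formula, the image is a strip with vertical sides *)
  hs_R3 : exists u v : R, forall x y, R3 b3 t3 (x, y) ->
    f (x, y) = (u - lam * x, v - sig * y);
  hs_R3_image : f @` R3 b3 t3 `<=` square;
  hs_R2 : forall p, R2 sig b3 p -> ~ square (f p);
  hs_psi1 : {within `[0, 1]%classic, continuous psi1};
  hs_psi2 : {within `[0, 1]%classic, continuous psi2};
  hs_strip4 : forall x, 0 <= x <= 1 ->
    [/\ t3 < psi1 x, psi1 x < psi2 x & psi2 x < bot5 sig];
  hs_R4_sides : forall x, 0 <= x <= 1 ->
    (R2 sig b3 `\` f @` R1 sig) (f (x, psi1 x)) /\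
    (R2 sig b3 `\` f @` R1 sig) (f (x, psi2 x));
  hs_R4_left : forall y, R4 psi1 psi2 (0, y) ->
    (f (0, y)).2 = c * ((f (0, y)).1 - q) ^+ 2;
  hs_R4_left_expand : forall y, R4 psi1 psi2 (0, y) ->
    sig <= enorm (ddy f (0, y));
  hs_R4_left_right : forall y, R4 psi1 psi2 (0, y) ->
    ~ ([set 1] `*` `[0, 1]) (f (0, y));
  hs_R4_graph : forall x y, R4 psi1 psi2 (x, y) ->
    (f (x, y)).2 = c * ((f (x, y)).1 - q) ^+ 2 - lam * x;
  hs_R4_orth : forall p, R4 psi1 psi2 p -> dot (ddy f p) (ddx f p) = 0;
  hs_T : R4 psi1 psi2 (0, t) /\ f (0, t) = (q, 0);
  hs_T_contract : enorm (ddx f (0, t)) = lam;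
  hs_gaps : forall p, square p -> t3 < p.2 < bot5 sig -> ~ R4 psi1 psi2 p ->
    R2 sig b3 (f p) /\ sig^-1 < (f p).2;
  hs_Psi : forall x y, R4 psi1 psi2 (x, y) ->
    f (x, y) = Psi (lam * x, sig * (y - t))
}.

(* The intersection of the f ^ n (square) over n in Z; f ^ (- n) (square) is
   the preimage. *)
Definition Lambda {R : realType} (f : R * R -> R * R) : set (R * R) :=
  (\bigcap_n (iter n f @` square)) `&` (\bigcap_n (iter n f @^-1` square)).

Definition Sigma3 : Type := int -> 'I_3.

Definition shift3 (xi : Sigma3) : Sigma3 := fun k => xi (k + 1).

Definition differ_at (xi xi' : Sigma3) (n : nat) : bool :=
  (xi n%:Z != xi' n%:Z) || (xi (- n%:Z) != xi' (- n%:Z)).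

(* If m is the least absolute value of an index where xi and xi' differ, they
   agree on [- n, n] exactly for n < m, and the distance is 2 ^ - (m - 1).  This
   reads as 2 when m = 0, i.e., when xi 0 <> xi' 0. *)
Definition dist3 {R : realType} (xi xi' : Sigma3) : R :=
  if pselect (exists n, differ_at xi xi' n) is left ex
  then 2 * 2 ^- (ex_minn ex) else 0.

Lemma dist3P {R : realType} (xi xi' : Sigma3) (n : nat) :
  (forall k : int, - n%:Z <= k <= n%:Z -> xi k = xi' k) ->
  differ_at xi xi' n.+1 -> dist3 xi xi' = 2 ^- n :> R.
Proof.
move=> agree diff; rewrite /dist3; case: pselect => [ex|]; last first.
  by case; exists n.+1.
case: ex_minnP => m diffm minm.
suff -> : m = n.+1.
  by rewrite exprS invfM mulrA divff ?mul1r// pnatr_eq0.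
apply/eqP; rewrite eqn_leq minm//= ltnNge; apply/negP => lemn.
have le0n (i : nat) : - i%:Z <= i%:Z by rewrite (@le_trans _ _ 0)// oppr_le0.
move: diffm; rewrite /differ_at !agree ?eqxx//.
- by rewrite lerN2 lez_nat lemn (le_trans (le0n m)).
- by rewrite lez_nat lemn (le_trans _ (le0n m))// lerN2.
Qed.

Definition hoelder_continuous {R : realType} (Theta : Sigma3 -> R * R) : Prop :=
  exists C alpha : R, [/\ 0 < C, 0 < alpha <= 1 &
    forall xi xi', enorm (Theta xi - Theta xi') <= C * dist3 xi xi' `^ alpha].

Definition semiconjugacy {R : realType} (f : R * R -> R * R)
  (Theta : Sigma3 -> R * R) : Prop :=
  [/\ forall xi, Lambda f (Theta xi),
      forall p, Lambda f p -> exists xi, Theta xi = p &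
      forall xi, Theta (shift3 xi) = f (Theta xi)].

Definition finite_to_one {R : realType} (Theta : Sigma3 -> R * R) : Prop :=
  forall p, finite_set (Theta @^-1` [set p]).

(* Main.v *)
Require Import Defs.
From HB Require Import structures.
From mathcomp Require Import all_boot all_order all_algebra.
From mathcomp Require Import all_classical all_reals all_analysis.
From mathcomp Require Import ring lra zify.
Import Order.TTheory GRing.Theory Num.Theory numFieldNormedType.Exports.
Local Open Scope classical_set_scope.
Local Open Scope ring_scope.

(* Code a point by the strips visited by its orbit: symbol 0 for R1, and symbols 1
   and 2 for the rest of the square below and above the height t of the tangency.
   A step of the orbit is described by cross maps (x, y') |-> (x', y), where
   (x', y') = f (x, y).  They are affine contractions, except at the fold, where
     x' = q +- sqrt ((y' + lam x) / c)
   is only Hoelder.  In the coordinates sqrt x, sqrt y this becomes a Lipschitz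
   map with constant of order c ^ (- 1 / 2), so that all cross maps contract by
   1 / 2: every symbol sequence is followed by exactly one orbit, and this orbit
   depends on the sequence in a Lipschitz way.  A point has two codes only if its
   orbit meets the tangency point (0, t), which happens at most once.

   In R4, the graph and orthogonality conditions give
     dX/dx = lam s / (1 + s ^ 2), s = 2 c (X - q),
   for the first coordinate X of f.  This controls horizontal displacements.
   Vertical expansion is assumed on the side x = 0 only.  One fixed map with the
   same Psi is used to carry it over: for that map, a piece of R4 independent of
   the other parameters is swept by horizontal segments starting on x = 0, and
   if lam and 1 / sig are small, the relevant part of R4 for f corresponds under
   Gamma to a subset of that piece. *)

Set Implicit Arguments.
Unset Strict Implicit.
Unset Printing Implicit Defensive.

(** * Calculus on horizontal and vertical lines *)

Section RealLine.
Context {R : realType}.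
Implicit Types (g : R * R -> R) (F : R -> R).

Lemma is_derive_ddx g (x y : R) :
  C1_fun g -> is_derive x (1 : R) (fun x' => g (x', y)) (ddx g (x, y)).
Proof.
case=> dgx _ _ _; have := dgx (x, y).
rewrite /derivable /ddx /derive => Dg.
suff E : (fun h : R => h^-1 *: (((fun x' => g (x', y)) \o shift x) (h *: (1 : R)) - g (x, y)))
   = (fun h : R => h^-1 *: ((g \o shift (x, y)) (h *: ((1, 0) : R * R)) - g (x, y))).
  by split; rewrite /derivable /derive E.
apply/funext => h /=; congr (_ *: (g _ - _)).
by apply: injective_projections; rewrite /= ?scaler0 ?add0r.
Qed.

Lemma is_derive_ddy g (x y : R) :
  C1_fun g -> is_derive y (1 : R) (fun y' => g (x, y')) (ddy g (x, y)).
Proof.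
case=> _ dgy _ _; have := dgy (x, y).
rewrite /derivable /ddy /derive => Dg.
suff E : (fun h : R => h^-1 *: (((fun y' => g (x, y')) \o shift y) (h *: (1 : R)) - g (x, y)))
   = (fun h : R => h^-1 *: ((g \o shift (x, y)) (h *: ((0, 1) : R * R)) - g (x, y))).
  by split; rewrite /derivable /derive E.
apply/funext => h /=; congr (_ *: (g _ - _)).
by apply: injective_projections; rewrite /= ?scaler0 ?add0r.
Qed.

Lemma derive_continuous F (dF : R -> R) :
  (forall x : R, is_derive x (1 : R) F (dF x)) -> continuous F.
Proof.
by move=> HF x; apply/differentiable_continuous/derivable1_diffP; case: (HF x).
Qed.

Lemma derive_homo F (dF : R -> R) a b : a <= b ->
  (forall x : R, is_derive x (1 : R) F (dF x)) ->
  (forall x, a < x < b -> 0 <= dF x) -> F a <= F b.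
Proof.
move=> ab HF pos; move: ab; rewrite le_eqVlt => /predU1P[->//|ab].
have [|z + E] := @MVT _ F dF a b ab (fun x _ => HF x).
  exact/continuous_subspaceT/(derive_continuous HF).
rewrite in_itv/= => zab; rewrite -subr_ge0 E mulr_ge0 ?pos//.
by rewrite subr_ge0 ltW.
Qed.

Lemma derive_antihomo F (dF : R -> R) a b : a <= b ->
  (forall x : R, is_derive x (1 : R) F (dF x)) ->
  (forall x, a < x < b -> dF x <= 0) -> F b <= F a.
Proof.
move=> ab HF neg; rewrite -lerN2.
have HN (x : R) : is_derive x (1 : R) (- F) (- dF x) by exact: is_deriveN.
by apply: (derive_homo ab HN) => x /neg; rewrite oppr_ge0.
Qed.

Lemma derive_near_cst F (d e x : R) :
  (\forall y \near x, F y = e) -> is_derive x (1 : R) F d -> d = 0.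
Proof.
move=> FE HF; have [_ <-] := HF.
have HC : is_derive x (1 : R) (cst e : R -> R) 0 by exact: is_derive_cst.
by have [_ <-] := HC; exact: near_eq_derive.
Qed.

(** A continuation argument: F is positive before the supremum of the points reached, nonnegative
    there by continuity, nonzero by hypothesis, hence positive a little beyond. The hypothesis on x
    gives access to positivity before x, so that differential equations valid there can be used. *)
Lemma pos_no_first_zero F (a b : R) : a <= b -> {within `[a, b], continuous F} ->
  0 < F a -> (forall x, a < x <= b -> (forall y, a <= y < x -> 0 < F y) -> 0 <= F x -> F x != 0) ->
  forall x, a <= x <= b -> 0 < F x.
Proof.
move=> ab Fc Fa noz.
have cF x : a <= x <= b -> forall e : R, 0 < e -> exists2 d : R, 0 < d &
    forall y, a <= y <= b -> `|y - x| < d -> `|F y - F x| < e.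
  move=> xab e e0; move/subspace_continuousP: Fc => /(_ x).
  rewrite /= in_itv/= => /(_ xab) /cvgrPdist_lt /(_ e e0).
  rewrite near_withinE => /nbhs_ballP[d/= d0 Hd].
  exists d => // y yab yx; rewrite distrC; apply: Hd.
    by rewrite /ball/= distrC.
  by rewrite in_itv.
pose S := [set x | a <= x <= b /\ forall y, a <= y <= x -> 0 < F y].
have Sa : S a by split=> [|y]; rewrite ?lexx// -eq_le => /eqP <-.
have hS : has_sup S.
  by split; [exists a|exists b => x [/andP[]]].
have aS : a <= sup S by apply: ub_le_sup => //; case: hS.
have bS : sup S <= b by apply: ge_sup; [exists a|move=> x [/andP[]]].
have Sab : a <= sup S <= b by rewrite aS.
have below y : a <= y < sup S -> 0 < F y.
  move=> /andP[ay yS]; have [z [zab Sz] yz] : exists2 z, S z & y < z.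
    have /sup_adherent-/(_ S hS)[z Sz] : 0 < sup S - y by rewrite subr_gt0.
    by rewrite subKr => yz; exists z.
  by apply: Sz; rewrite ay ltW.
have SS : 0 < F (sup S).
  have F0 : 0 <= F (sup S).
    rewrite leNgt; apply/negP => Fneg.
    have [|d d0 Hd] := cF (sup S) Sab (- F (sup S)); first by rewrite oppr_gt0.
    have [Ea|aS'] := eqVneq a (sup S); first by move: Fa; rewrite Ea; lra.
    have {}aS' : a < sup S by rewrite lt_neqAle aS'.
    pose y := Num.max a (sup S - d / 2).
    have yS : y < sup S by rewrite gt_max aS'; lra.
    have ay : a <= y by rewrite le_max lexx.
    have := below y; rewrite ay yS => /(_ isT).
    have yd : sup S - d / 2 <= y by rewrite le_max lexx orbT.
    have /Hd : a <= y <= b by rewrite ay; lra.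
    rewrite !ltr_norml; move=> /(_ _)/andP[|]; lra.
  have [Ea|aS'] := eqVneq a (sup S); first by rewrite -Ea.
  have := noz (sup S); rewrite bS lt_neqAle aS' aS => /(_ isT below F0).
  by rewrite lt_def F0 andbT.
have [Sb|Sb] := eqVneq (sup S) b.
  move=> x /andP[ax]; rewrite le_eqVlt -Sb => /predU1P[->//|xb].
  by apply: below; rewrite ax.
have {}Sb : sup S < b by rewrite lt_neqAle Sb.
have [d d0 Hd] := cF (sup S) Sab (F (sup S)) SS.
pose z := Num.min b (sup S + d / 2).
have Sz : sup S < z by rewrite lt_min Sb; lra.
have zb : z <= b by rewrite ge_min lexx.
have zd : z <= sup S + d / 2 by rewrite ge_min lexx orbT.
have : S z.
  split=> [|y /andP[ay yz]]; first by rewrite zb andbT; lra.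
  have [yS|yS] := ltP y (sup S); first by apply: below; rewrite ay.
  have /Hd : a <= y <= b by rewrite ay; lra.
  rewrite !ltr_norml => /(_ _)/andP[|]; lra.
by case: hS => _ hub /(ub_le_sup hub); rewrite leNgt Sz.
Qed.

Lemma pos_no_last_zero F (a b : R) : a <= b -> {within `[a, b], continuous F} ->
  0 < F b -> (forall x, a <= x < b -> (forall y, x < y <= b -> 0 < F y) -> 0 <= F x -> F x != 0) ->
  forall x, a <= x <= b -> 0 < F x.
Proof.
move=> ab Fc Fb noz x xab.
rewrite -[x]opprK; apply: (@pos_no_first_zero (F \o -%R) (- b) (- a)).
- by rewrite lerN2.
- by apply/within_continuous_compN; rewrite !opprK.
- by rewrite /= opprK.
- move=> y yab pos /=; apply: noz; first lra.
  by move=> z zy; have := pos (- z); rewrite /= opprK; apply; lra.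
- by lra.
Qed.

Lemma continuous_ddx_vertical g (x : R) :
  C1_fun g -> continuous (fun y => ddx g (x, y)).
Proof.
case=> _ _ gc _ y.
apply: (@cvg_comp _ _ _ (fun y => (x, y)) (ddx g) (nbhs y) (nbhs (x, y))); last exact: gc.
exact: (@cvg_pair _ _ _ (nbhs y) (nbhs x) (nbhs y) _ _ _ (cst x) id (cvg_cst x)
  (@cvg_id _ (nbhs y))).
Qed.

Lemma derive_pair (f : R * R -> R * R) p v :
  derivable (fun p => (f p).1) p v -> derivable (fun p => (f p).2) p v ->
  'D_v f p = ('D_v (fun p => (f p).1) p, 'D_v (fun p => (f p).2) p).
Proof.
move=> d1 d2; rewrite /derive; apply: (cvg_lim (@norm_hausdorff _ (R * R)%type)).
pose F1 h := h^-1 *: (((fun p => (f p).1) \o shift p) (h *: v) - (f p).1).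
pose F2 h := h^-1 *: (((fun p => (f p).2) \o shift p) (h *: v) - (f p).2).
have -> : (fun h : R => h^-1 *: ((f \o shift p) (h *: v) - f p)) =
    (fun h => (F1 h, F2 h)).
  by apply/funext => h; apply: injective_projections.
exact: (@cvg_pair _ _ _ (0^') _ _ _ _ _ F1 F2 d1 d2).
Qed.

Lemma continuous_ddy_vertical g (x : R) :
  C1_fun g -> continuous (fun y => ddy g (x, y)).
Proof.
case=> _ _ _ gc y.
apply: (@cvg_comp _ _ _ (fun y => (x, y)) (ddy g) (nbhs y) (nbhs (x, y))); last exact: gc.
exact: (@cvg_pair _ _ _ (nbhs y) (nbhs x) (nbhs y) _ _ _ (cst x) id (cvg_cst x)
  (@cvg_id _ (nbhs y))).
Qed.

End RealLine.

Lemma near_right {R : realType} (P : R -> Prop) (a b : R) : a < b ->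
  (\forall z \near a, P z) -> exists2 y, a < y < b & forall z, a <= z <= y -> P z.
Proof.
move=> ab /nbhs_ballP[e /= e0 He]; pose y := Num.min (a + e / 2) ((a + b) / 2).
have y1 : y <= a + e / 2 by rewrite ge_min lexx.
have y2 : y <= (a + b) / 2 by rewrite ge_min lexx orbT.
have y3 : a < y by rewrite lt_min; lra.
exists y => [|z zy]; first lra.
by apply: He; rewrite /ball/= ltr_norml; lra.
Qed.

Lemma near_left {R : realType} (P : R -> Prop) (a b : R) : b < a ->
  (\forall z \near a, P z) -> exists2 y, b < y < a & forall z, y <= z <= a -> P z.
Proof.
move=> ab /nbhs_ballP[e /= e0 He]; pose y := Num.max (a - e / 2) ((a + b) / 2).
have y1 : a - e / 2 <= y by rewrite le_max lexx.
have y2 : (a + b) / 2 <= y by rewrite le_max lexx orbT.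
have y3 : y < a by rewrite gt_max; lra.
exists y => [|z zy]; first lra.
by apply: He; rewrite /ball/= ltr_norml; lra.
Qed.

Lemma near_gt {R : realType} (F : R -> R) (a k : R) : {for a, continuous F} ->
  k < F a -> \forall z \near a, k < F z.
Proof. by move=> Fc; exact: (cvgr_gt (F a) Fc). Qed.

Lemma near_lt {R : realType} (F : R -> R) (a k : R) : {for a, continuous F} ->
  F a < k -> \forall z \near a, F z < k.
Proof. by move=> Fc; exact: (cvgr_lt (F a) Fc). Qed.

Lemma sqr_between {R : realType} (a b z : R) :
  (a <= z <= b) || (b <= z <= a) -> a ^+ 2 <= b ^+ 2 -> z ^+ 2 <= b ^+ 2.
Proof.
rewrite -(real_normK (num_real a)) -(real_normK (num_real b)) -(real_normK (num_real z)).
rewrite !ler_pXn2r ?nnegrE// => zi ab; rewrite ler_norml.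
have := ler_norm a; have := ler_norm b; have := ler_norm (- a); have := ler_norm (- b).
by rewrite !normrN; move: zi => /orP[]; lra.
Qed.

(** * The fold region R4 *)

Section Fold.
Context {R : realType} {lam sig c q t b3 t3 : R} {psi1 psi2 : R -> R}
  {Psi f : R * R -> R * R}.
Implicit Types x y : R.
Hypothesis H : horseshoe lam sig c q t b3 t3 psi1 psi2 Psi f.

Local Notation X x y := (f (x, y)).1.
Local Notation Y x y := (f (x, y)).2.
Local Notation Xx x y := (ddx (fun p => (f p).1) (x, y)).
Local Notation Xy x y := (ddy (fun p => (f p).1) (x, y)).
Local Notation Yx x y := (ddx (fun p => (f p).2) (x, y)).
Local Notation Yy x y := (ddy (fun p => (f p).2) (x, y)).
Local Notation s x y := (2 * c * (X x y - q)).

Let C1X : C1_fun (fun p => (f p).1). Proof. by case: (hs_diffeo H) => -[[]]. Qed.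
Let C1Y : C1_fun (fun p => (f p).2). Proof. by case: (hs_diffeo H) => -[_ []]. Qed.

Lemma hs_inj : injective f.
Proof. by case: (hs_diffeo H) => _ [g [_ fg _]]; exact: can_inj fg. Qed.

Let lam0 : 0 < lam. Proof. by case/andP: (hs_lam H). Qed.
Let c0 : 0 < c. Proof. exact: hs_c H. Qed.
Let sig0 : 0 < sig. Proof. by have := hs_sig H; lra. Qed.

Let dXx (x y : R) : is_derive x (1 : R) (fun x => X x y) (Xx x y).
Proof. exact: (@is_derive_ddx _ (fun p => (f p).1)). Qed.
Let dXy (x y : R) : is_derive y (1 : R) (fun y => X x y) (Xy x y).
Proof. exact: (@is_derive_ddy _ (fun p => (f p).1)). Qed.
Let dYx (x y : R) : is_derive x (1 : R) (fun x => Y x y) (Yx x y).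
Proof. exact: (@is_derive_ddx _ (fun p => (f p).2)). Qed.
Let dYy (x y : R) : is_derive y (1 : R) (fun y => Y x y) (Yy x y).
Proof. exact: (@is_derive_ddy _ (fun p => (f p).2)). Qed.

Definition inside4 (p1 p2 : R -> R) (x y : R) := 0 <= x <= 1 /\ p1 x < y < p2 x.
Local Notation inside := (inside4 psi1 psi2).

Lemma R4_itv x y : R4 psi1 psi2 (x, y) <-> 0 <= x <= 1 /\ psi1 x <= y <= psi2 x.
Proof.
rewrite /R4 /square /=; split => [[[xi _] yi]|[xi yi]]; first by rewrite in_itv in xi.
split => //; rewrite !in_itv/=; split => //=.
have := hs_strip4 H xi; have := hs_strip3 H.
have : 0 < sig^-1 by rewrite invr_gt0.
by rewrite /bot5 => ? [? ?] [? ? ?]; lra.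
Qed.

Lemma inside_R4 x y : inside x y -> R4 psi1 psi2 (x, y).
Proof. by case=> xi /andP[? ?]; apply/R4_itv; split => //; rewrite !ltW. Qed.

(** The top and bottom sides of R4 are mapped into R2, which lies above the height [sig^-1]. *)
Lemma R4_low x y : R4 psi1 psi2 (x, y) -> Y x y <= sig^-1 -> inside x y.
Proof.
move=> /R4_itv[xi /andP[y1 y2]] Ylow; split => //.
have [[[_ s1] _] [[_ s2] _]] := hs_R4_sides H xi.
apply/andP; split; rewrite lt_neqAle ?y1 ?y2 andbT; apply/eqP => E.
- by move: s1; rewrite E /=; lra.
- by move: s2; rewrite -E /=; lra.
Qed.

Lemma Y_graph x y : R4 psi1 psi2 (x, y) -> Y x y = c * (X x y - q) ^+ 2 - lam * x.
Proof. exact: (hs_R4_graph H). Qed.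

(** On a vertical line the graph condition makes Y a function of X, so equal X means equal
    images. *)
Lemma R4_X_inj x y y' : R4 psi1 psi2 (x, y) -> R4 psi1 psi2 (x, y') ->
  X x y = X x y' -> y = y'.
Proof.
move=> yi yi' E; have /hs_inj [//] : f (x, y) = f (x, y').
by apply: injective_projections => //; rewrite !Y_graph// E.
Qed.

(** Turns the position between the two boundary curves into the sign of one continuous function of
    x, the form that [pos_no_first_zero] needs. *)
Let Pf (y x : R) := (y - psi1 x) * (psi2 x - y).

Let insideP x y : 0 <= x <= 1 -> (inside x y <-> 0 < Pf y x).
Proof.
move=> xi; have [? ? ?] := hs_strip4 H xi; rewrite /Pf; split => [[_ ?]|].
  by apply: mulr_gt0; lra.
move=> P; split => //.
have [?|?] := ltP (psi1 x) y; last by nra.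
have [?|?] := ltP y (psi2 x); last by nra.
by [].
Qed.

Let Pf_continuous y (a b : R) : 0 <= a -> b <= 1 -> {within `[a, b], continuous (Pf y)}.
Proof.
move=> a0 b1; have sub : `[a, b] `<=` `[0, 1].
  by move=> x /=; rewrite !in_itv/=; lra.
have c1 := continuous_subspaceW sub (hs_psi1 H).
have c2 := continuous_subspaceW sub (hs_psi2 H).
have cy : {within `[a, b], continuous (cst y : R -> R)}.
  by apply: continuous_subspaceT; exact: cst_continuous.
have k1 := within_continuousB cy c1; have k2 := within_continuousB c2 cy.
by move=> x; apply: cvgM; [exact: k1|exact: k2].
Qed.

Let near_inside x y : 0 < x < 1 -> inside x y -> \forall x' \near x, inside x' y.
Proof.
move=> xi yin; have xi' : 0 <= x <= 1 by lra.
have P0 := (insideP y xi').1 yin.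
have xI : x \in `]0, 1[ by rewrite in_itv.
have /continuous_within_itvP-/(_ ltr01)[Pc _ _] := @Pf_continuous y 0 1 (lexx 0) (lexx 1).
have {}Pc := Pc x xI; near=> x'; apply/insideP.
  have : x' \in `]0, 1[ by near: x'; exact: near_in_itvoo.
  by rewrite in_itv/=; lra.
by near: x'; exact: (cvgr_gt _ Pc).
Unshelve. all: by end_near. Qed.

Let near_inside_vertical x y : inside x y -> \forall y' \near y, inside x y'.
Proof.
move=> [xi yi]; have yI : y \in `]psi1 x, psi2 x[ by rewrite in_itv.
near=> y'; split => //.
suff : y' \in `]psi1 x, psi2 x[ by rewrite in_itv.
by near: y'; exact: near_in_itvoo.
Unshelve. all: by end_near. Qed.

Let is_derive_sqrdist (F : R -> R) (dF x : R) : is_derive x (1 : R) F dF ->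
  is_derive x (1 : R) (fun x => (F x - q) ^+ 2) (2 * (F x - q) * dF).
Proof.
move=> DF.
have D1 : is_derive x (1 : R) (fun x => F x - q) dF.
  by apply: (is_derive_eq (is_deriveB DF (is_derive_cst q x (1 : R)))); rewrite subr0.
by apply: (is_derive_eq (is_deriveM D1 D1)); rewrite /GRing.scale/=; ring.
Qed.

(** Meant for the defect of the graph condition, which is locally constant on lines: k = [lam]
    serves for horizontal lines and k = 0 for vertical ones. *)
Let is_derive_defect (F G : R -> R) (dF dG x k : R) :
  is_derive x (1 : R) F dF -> is_derive x (1 : R) G dG ->
  is_derive x (1 : R) (fun x => G x - c * (F x - q) ^+ 2 + k * x)
    (dG - 2 * c * (F x - q) * dF + k).
Proof.
move=> DF DG.
have D1 := is_deriveZ c (is_derive_sqrdist DF).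
have D2 := is_deriveZ k (is_derive_id x (1 : R)).
by apply: (is_derive_eq (is_deriveD (is_deriveB DG D1) D2)); rewrite /GRing.scale/=; ring.
Qed.

Lemma Yx_fold x y : 0 < x < 1 -> inside x y -> Yx x y = s x y * Xx x y - lam.
Proof.
move=> xi yin; have := is_derive_defect lam (dXx x y) (dYx x y).
move/(@derive_near_cst _ _ _ 0) => E; suff : Yx x y - s x y * Xx x y + lam = 0 by lra.
apply: E; near=> x'; rewrite Y_graph; first by ring.
by apply: inside_R4; near: x'; exact: near_inside.
Unshelve. all: by end_near. Qed.

Lemma Yy_fold x y : inside x y -> Yy x y = s x y * Xy x y.
Proof.
move=> yin; have := is_derive_defect 0 (dXy x y) (dYy x y).
move/(@derive_near_cst _ _ _ (- (lam * x))) => E.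
suff : Yy x y - s x y * Xy x y + 0 = 0 by lra.
apply: E; near=> y'; rewrite Y_graph; first by ring.
by apply: inside_R4; near: y'; exact: near_inside_vertical.
Unshelve. all: by end_near. Qed.

(* Where Xy vanishes the orthogonality condition is void; but Xy cannot vanish
   on a vertical segment, since f is injective, so continuity fills the gaps. *)
Lemma Xx_fold x y : 0 < x < 1 -> inside x y ->
  Xx x y = lam * s x y / (1 + s x y ^+ 2).
Proof.
move=> xi yin.
have Dpos z : 1 + s x z ^+ 2 != 0 by rewrite gt_eqF// ltr_pwDl// sqr_ge0.
apply/eqP; rewrite -subr_eq0; apply/negPn/negP => E0.
pose E z := Xx x z * (1 + s x z ^+ 2) - lam * s x z.
have Ec : {for y, continuous E}.
  have Xc : {for y, continuous (fun z => X x z)} by exact: (derive_continuous (dXy x)).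
  have Xxc : {for y, continuous (fun z => Xx x z)}.
    by have C := @continuous_ddx_vertical _ _ x C1X; exact: C.
  rewrite /E; apply: cvgB; last apply: cvgMl_tmp.
    apply: cvgM => //; apply: cvgD; first exact: cvg_cst.
    by apply: cvgM; (apply: cvgMl_tmp; apply: cvgB => //; exact: cvg_cst).
  by apply: cvgMl_tmp; apply: cvgB => //; exact: cvg_cst.
have Ey0 : E y != 0.
  apply: contra E0 => /eqP Ey; apply/eqP.
  have -> : Xx x y = (E y + lam * s x y) / (1 + s x y ^+ 2).
    by rewrite /E subrK mulfK.
  by rewrite Ey add0r subrr.
have Xy0 z : inside x z -> E z != 0 -> Xy x z = 0.
  move=> zin Ez; have := hs_R4_orth H (inside_R4 zin).
  rewrite /dot /ddx /ddy !derive_pair; try by case: C1X; case: C1Y.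
  rewrite /= -/(Xx x z) -/(Yx x z) -/(Xy x z) -/(Yy x z).
  rewrite Yx_fold// Yy_fold// => O.
  (* With Yy = s Xy and Yx = s Xx - lam, the scalar product is Xy (Xx (1 + s^2) - lam s). *)
  have : Xy x z * E z = 0 by rewrite -[RHS]O /E; ring.
  by move/eqP; rewrite mulf_eq0 (negPf Ez) orbF => /eqP.
have : \forall z \near y, inside x z /\ E z != 0.
  near=> z; split; near: z; first exact: near_inside_vertical.
  exact: (cvgr_neq0 (E y) Ec).
move=> /nbhs_ballP[e /= e0 He].
have Hz z : y - e < z < y + e -> inside x z /\ Xy x z = 0.
  move=> ze; have [] : inside x z /\ E z != 0.
    by apply: He; rewrite /ball/= ltr_norml; lra.
  by move=> zin Ez; split=> //; exact: Xy0.
have ye : y <= y + e / 2 by lra.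
have E1 : X x y <= X x (y + e / 2).
  apply: (derive_homo ye (dXy x)) => z zi.
  by have [|_ ->] := Hz z; [lra|].
have E2 : X x (y + e / 2) <= X x y.
  apply: (derive_antihomo ye (dXy x)) => z zi.
  by have [|_ ->] := Hz z; [lra|].
have [|zin _] := Hz (y + e / 2); first lra.
have := R4_X_inj (inside_R4 yin) (inside_R4 zin) _.
move/(_ (le_anti _)); rewrite E1 E2 => /(_ isT); lra.
Unshelve. all: by end_near. Qed.

(** All three follow from the formula for Xx: Yx = - lam / (1 + s^2), the derivative of (X - q)^2 is
    4 c lam (X - q)^2 / (1 + s^2), and |Xx| <= lam because |s| <= 1 + s^2. *)
Lemma fold_segment a b y : 0 <= a -> a <= b -> b <= 1 ->
  (forall x, a < x < b -> inside x y) ->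
  [/\ Y b y <= Y a y, (X a y - q) ^+ 2 <= (X b y - q) ^+ 2 &
      `|X b y - X a y| <= lam * (b - a)].
Proof.
move=> a0 ab b1 ins.
have Xxs x : a < x < b -> Xx x y = lam * s x y / (1 + s x y ^+ 2).
  by move=> xi; rewrite Xx_fold//; [lra|exact: ins].
have Dpos x : 0 < 1 + s x y ^+ 2 by rewrite ltr_pwDl// sqr_ge0.
have Xxb x : a < x < b -> - lam <= Xx x y <= lam.
  move=> xi; rewrite Xxs// ler_pdivlMr// ler_pdivrMr//; set w := s x y.
  have w1 : 0 <= 1 + w ^+ 2 - w by nra.
  have w2 : 0 <= 1 + w ^+ 2 + w by nra.
  have := mulr_ge0 (ltW lam0) w1; have := mulr_ge0 (ltW lam0) w2.
  by rewrite mulrBr !mulrDr mulNr; lra.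
split.
- apply: (derive_antihomo ab (fun x => dYx x y)) => x xi.
  rewrite Yx_fold; [|lra|exact: ins]; rewrite Xxs//.
  have -> : s x y * (lam * s x y / (1 + s x y ^+ 2)) - lam = - lam / (1 + s x y ^+ 2).
    by have /lt0r_neq0 := Dpos x; set w := s x y => ?; field.
  by rewrite mulNr oppr_le0 divr_ge0// ltW.
- apply: (derive_homo ab (fun x => is_derive_sqrdist (dXx x y))) => x xi.
  have -> : 2 * (X x y - q) * Xx x y =
      (4 * c * lam) * ((X x y - q) ^+ 2 / (1 + s x y ^+ 2)).
    rewrite Xxs//; have /lt0r_neq0 := Dpos x.
    by set d := 1 + _ => ?; field.
  by rewrite mulr_ge0// ?divr_ge0 ?sqr_ge0// ?ltW// !mulr_gt0.
- have D x := is_deriveZ lam (is_derive_id x (1 : R)).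
  have DX x := is_deriveD (D x) (dXx x y); have DN x := is_deriveB (D x) (dXx x y).
  have : (fun z => lam * z + X z y) a <= (fun z => lam * z + X z y) b.
    by apply: (derive_homo ab DX) => x /Xxb; rewrite /GRing.scale/=; lra.
  have : (fun z => lam * z - X z y) a <= (fun z => lam * z - X z y) b.
    by apply: (derive_homo ab DN) => x /Xxb; rewrite /GRing.scale/=; lra.
  by rewrite /= ler_norml; lra.
Qed.

(** Moving right lowers Y, so a low point stays low and cannot reach a side of R4, whose image is
    higher. *)
Lemma fold_right x0 x y : R4 psi1 psi2 (x0, y) -> Y x0 y <= sig^-1 ->
  x0 <= x <= 1 -> inside x y.
Proof.
move=> in4 low xi; have ins0 := R4_low in4 low; have x0i := ins0.1.
have [x00 x01] : 0 <= x0 /\ x0 <= 1 by lra.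
apply/insideP; first lra.
apply: (@pos_no_first_zero _ (Pf y) x0 1) => //; first exact: Pf_continuous.
  by apply/insideP.
move=> z zi pos Pz0; apply/eqP => Pz.
have z01 : 0 <= z <= 1 by lra.
have in4z : R4 psi1 psi2 (z, y).
  have [? ? ?] := hs_strip4 H z01; apply/R4_itv; split => //.
  by move/eqP: Pz; rewrite /Pf mulf_eq0 => /orP[] /eqP; lra.
have [||||Yz _ _] := @fold_segment x0 z y; [lra|lra|lra| |].
  by move=> w wi; apply/insideP; [lra|apply: pos; lra].
have /insideP-/(_ z01) : inside z y by apply: R4_low => //; exact: le_trans Yz low.
by rewrite Pz ltxx.
Qed.

(** Moving left may raise Y, but not c (X - q)^2, which bounds Y from above; hence the stronger
    hypothesis than in [fold_right]. *)
Lemma fold_left x0 x y : R4 psi1 psi2 (x0, y) -> c * (X x0 y - q) ^+ 2 <= sig^-1 ->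
  0 <= x <= x0 -> inside x y.
Proof.
move=> in4 low xi; have [x0i _] := (R4_itv x0 y).1 in4.
have ins0 : inside x0 y.
  apply: R4_low => //; rewrite Y_graph//.
  have : 0 <= lam * x0 by apply: mulr_ge0; [exact: ltW|lra].
  by lra.
have [x00 x01] : 0 <= x0 /\ x0 <= 1 by lra.
apply/insideP; first lra.
apply: (@pos_no_last_zero _ (Pf y) 0 x0) => //; first exact: Pf_continuous.
  by apply/insideP.
move=> z zi pos Pz0; apply/eqP => Pz.
have z01 : 0 <= z <= 1 by lra.
have in4z : R4 psi1 psi2 (z, y).
  have [? ? ?] := hs_strip4 H z01; apply/R4_itv; split => //.
  by move/eqP: Pz; rewrite /Pf mulf_eq0 => /orP[] /eqP; lra.
have [||||_ Xz _] := @fold_segment z x0 y; [lra|lra|lra| |].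
  by move=> w wi; apply/insideP; [lra|apply: pos; lra].
have /insideP-/(_ z01) : inside z y.
  apply: R4_low => //; rewrite Y_graph//.
  have : 0 <= lam * z by apply: mulr_ge0; [exact: ltW|lra].
  have : c * (X z y - q) ^+ 2 <= c * (X x0 y - q) ^+ 2 by rewrite ler_pM2l.
  by lra.
by rewrite Pz ltxx.
Qed.

(** The image of (0, t) has height 0, so the whole line y = t stays in R4. Along it X keeps the
    value q, an equilibrium of the equation for X: every vertical line has the vertex of its image
    on y = t. *)
Lemma fold_tip x : 0 <= x <= 1 -> inside x t /\ X x t = q.
Proof.
move=> xi; have [in4 fT] := hs_T H.
have ins z : 0 <= z <= 1 -> inside z t.
  move=> zi; apply: (@fold_right 0) => //.
  by rewrite fT /= invr_ge0 ltW.
split; first exact: ins.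
have [x0 x1] : 0 <= x /\ x <= 1 by lra.
(* Uniqueness for the equation satisfied by X: (X - q) ^ 2 exp (- 4 c lam x)
   is nonincreasing and vanishes at x = 0. *)
have DE (z : R) : is_derive z (1 : R) (fun z => expR (- (4 * c * lam) * z))
    (expR (- (4 * c * lam) * z) * (- (4 * c * lam))).
  have D1 := is_deriveZ (- (4 * c * lam)) (is_derive_id z (1 : R)).
  apply: (is_derive_eq (is_derive1_comp (is_derive_expR _) D1)).
  by rewrite /GRing.scale/= mulr1.
have := @derive_antihomo _ (fun z => (X z t - q) ^+ 2 * expR (- (4 * c * lam) * z)) _ _ _
  x0 (fun z => is_deriveM (is_derive_sqrdist (dXx z t)) (DE z)) _.
rewrite fT /= subrr expr0n mul0r => W.
have : (X x t - q) ^+ 2 * expR (- (4 * c * lam) * x) <= 0.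
  apply: W => z zi; have zin : inside z t by apply: ins; lra.
  rewrite Xx_fold//; last lra.
  rewrite /GRing.scale/=; set w := X z t - q; set e := expR _.
  have e0 : 0 < e by exact: expR_gt0.
  have d1 : 1 <= 1 + (2 * c * w) ^+ 2 by rewrite lerDl sqr_ge0.
  have -> : w ^+ 2 * (e * - (4 * c * lam)) +
      e * (2 * w * (lam * (2 * c * w) / (1 + (2 * c * w) ^+ 2))) =
      - ((4 * c * lam) * (w ^+ 2 * e) * (1 - (1 + (2 * c * w) ^+ 2)^-1)).
    by set d := _^-1; ring.
  have k1 : 0 <= 1 - (1 + (2 * c * w) ^+ 2)^-1.
    by rewrite subr_ge0 invf_le1// (lt_le_trans _ d1).
  have k2 : 0 <= w ^+ 2 * e by rewrite mulr_ge0 ?sqr_ge0 ?(ltW e0).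
  have k3 : 0 <= 4 * c * lam by rewrite !mulr_ge0 ?(ltW c0) ?(ltW lam0).
  by rewrite oppr_le0 mulr_ge0// mulr_ge0.
rewrite pmulr_lle0 ?expR_gt0// => W2.
have /eqP : (X x t - q) ^+ 2 = 0 by apply/eqP; rewrite eq_le W2 sqr_ge0.
by rewrite sqrf_eq0 subr_eq0 => /eqP.
Qed.

(** X is continuous and injective on a vertical segment of R4, hence monotone. *)
Lemma fold_vertical x y y' : R4 psi1 psi2 (x, y) -> R4 psi1 psi2 (x, y') ->
  forall z, y <= z <= y' ->
  (X x y <= X x z <= X x y') || (X x y' <= X x z <= X x y).
Proof.
move=> in4 in4' z zi; have [xi yi] := (R4_itv x y).1 in4.
have [_ yi'] := (R4_itv x y').1 in4'.
have Xc : {within `[y, y'], continuous (fun z => X x z)}.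
  exact/continuous_subspaceT/(derive_continuous (dXy x)).
have Xi : {in `[y, y'] &, injective (fun z => X x z)}.
  move=> z1 z2; rewrite !in_itv /= => z1i z2i; apply: R4_X_inj;
  by apply/R4_itv; split => //; lra.
have yz : y \in `[y, y'] by rewrite in_itv/=; lra.
have yz' : y' \in `[y, y'] by rewrite in_itv/=; lra.
have zz : z \in `[y, y'] by rewrite in_itv.
have [y1 y2] : y <= z /\ z <= y' by lra.
case: (itv_continuous_inj_mono Xc Xi) => mono; apply/orP; [left|right].
- by rewrite !(le_mono_in mono)// y1.
- by rewrite !(le_nmono_in mono)// y2.
Qed.

(** By monotonicity, moving towards the line y = t brings X towards q without crossing it. *)
Lemma fold_side x y z : R4 psi1 psi2 (x, y) -> (t <= z <= y \/ y <= z <= t) ->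
  [/\ R4 psi1 psi2 (x, z), (X x z - q) ^+ 2 <= (X x y - q) ^+ 2 &
     0 <= (X x z - q) * (X x y - q)].
Proof.
move=> in4 zi; have [xi yi] := (R4_itv x y).1 in4.
have [tin tq] := fold_tip xi; have t4 := inside_R4 tin.
have [_ ti] := (R4_itv x t).1 t4; split.
- by apply/R4_itv; split => //; lra.
- have : (q <= X x z <= X x y) || (X x y <= X x z <= q).
    rewrite -tq; case: zi => zi; first exact: fold_vertical.
    by rewrite orbC; exact: fold_vertical.
  by move=> /orP[]; nra.
- have : (q <= X x z <= X x y) || (X x y <= X x z <= q).
    rewrite -tq; case: zi => zi; first exact: fold_vertical.
    by rewrite orbC; exact: fold_vertical.
  by move=> /orP[]; nra.
Qed.

(** Mean value theorem: the squared norm of the vertical derivative is Xy^2 (1 + s^2), so the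
    assumed expansion together with s^2 <= 1 leaves |Xy| >= sig / 2. The bound on s extends to
    intermediate heights since X is monotone. *)
Lemma fold_expand_left y y' : R4 psi1 psi2 (0, y) -> R4 psi1 psi2 (0, y') ->
  s 0 y ^+ 2 <= 1 -> s 0 y' ^+ 2 <= 1 ->
  sig / 2 * `|y - y'| <= `|X 0 y - X 0 y'|.
Proof.
wlog yy : y y' / y < y'.
  move=> W i i' l l'; case: (ltgtP y y') => [yy|yy|->]; first exact: W.
    by rewrite distrC [leRHS]distrC; exact: W.
  by rewrite !subrr normr0 mulr0.
move=> i i' l l'; have [xi yi] := (R4_itv 0 y).1 i; have [_ yi'] := (R4_itv 0 y').1 i'.
have [z + E] := MVT yy (fun z _ => dXy 0 z)
  (continuous_subspaceT (derive_continuous (dXy 0))).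
rewrite in_itv/= => zi.
have zin : inside 0 z by split=> //; lra.
have lz : s 0 z ^+ 2 <= 1.
  have zi' : y <= z <= y' by lra.
  move: (fold_vertical i i' zi') l l' => + l l'; rewrite !exprMn in l l' *.
  have c1 : 0 <= 2 ^+ 2 * c ^+ 2 by rewrite mulr_ge0// sqr_ge0.
  have [le1|/ltW le1] := leP ((X 0 y - q) ^+ 2) ((X 0 y' - q) ^+ 2) => V.
    apply: le_trans l'; rewrite ler_wpM2l//; apply: sqr_between le1.
    by move: V => /orP[] /andP[? ?]; apply/orP; [left|right]; lra.
  apply: le_trans l; rewrite ler_wpM2l//; apply: sqr_between le1.
  by move: V => /orP[] /andP[? ?]; apply/orP; [right|left]; lra.
have := hs_R4_left_expand H (inside_R4 zin).
rewrite /enorm /ddy derive_pair; try by case: C1X; case: C1Y.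
rewrite /= -/(Xy 0 z) -/(Yy 0 z) Yy_fold// => S.
have S2 : sig ^+ 2 <= Xy 0 z ^+ 2 * (1 + s 0 z ^+ 2).
  rewrite (_ : _ * _ = Xy 0 z ^+ 2 + (s 0 z * Xy 0 z) ^+ 2); last by ring.
  rewrite -[leRHS]sqr_sqrtr ?addr_ge0 ?sqr_ge0//.
  by rewrite ler_pXn2r// nnegrE ?sqrtr_ge0// ltW.
have S3 : (sig / 2) ^+ 2 <= Xy 0 z ^+ 2.
  by move: S2 lz (sqr_ge0 (Xy 0 z)) (sqr_ge0 sig); nra.
rewrite distrC [leRHS]distrC E normrM ler_wpM2r//.
by rewrite -[leLHS]ger0_norm ?divr_ge0 ?(ltW sig0)// -ler_sqr ?nnegrE// !real_normK ?num_real.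
Qed.

(** Both points are moved left to x = 0, where expansion is known. The difference of their X
    coordinates does not decrease with x: with a and b the two values of s, its derivative is lam (a
    - b) (1 - a b) / ((1 + a^2) (1 + b^2)), and |a|, |b| <= 1. *)
Lemma fold_expand_self x y y' : R4 psi1 psi2 (x, y) -> R4 psi1 psi2 (x, y') ->
  c * (X x y - q) ^+ 2 <= sig^-1 -> c * (X x y' - q) ^+ 2 <= sig^-1 ->
  s x y ^+ 2 <= 1 -> s x y' ^+ 2 <= 1 ->
  sig / 2 * `|y - y'| <= `|X x y - X x y'|.
Proof.
wlog yy : y y' / X 0 y' <= X 0 y.
  move=> W i i' ? ? ? ?; case: (leP (X 0 y') (X 0 y)) => [yy|/ltW yy]; first exact: W.
  by rewrite distrC [leRHS]distrC; exact: W.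
move=> i i' l l' m m'; have [xi _] := (R4_itv x y).1 i.
have [x0 x1] : 0 <= x /\ x <= 1 by lra.
have ins z : 0 <= z <= x -> inside z y by move=> zi; apply: (fold_left i).
have ins' z : 0 <= z <= x -> inside z y' by move=> zi; apply: (fold_left i').
have shrink z w : 0 <= z <= x -> R4 psi1 psi2 (x, w) -> (forall z, 0 <= z <= x -> inside z w) ->
    s x w ^+ 2 <= 1 -> s z w ^+ 2 <= 1.
  move=> zi iw insw; apply: le_trans; rewrite !exprMn ler_wpM2l ?mulr_ge0 ?sqr_ge0 ?(ltW c0)//.
  have [||||_ W _] := @fold_segment z x w; [lra|lra|lra| |exact: W].
  by move=> v vi; apply: insw; lra.
have mz z : 0 <= z <= x -> s z y ^+ 2 <= 1 by move=> ?; apply: shrink.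
have mz' z : 0 <= z <= x -> s z y' ^+ 2 <= 1 by move=> ?; apply: shrink.
have z00 : (0 : R) <= 0 <= x by lra.
have L := fold_expand_left (inside_R4 (ins 0 z00)) (inside_R4 (ins' 0 z00))
  (mz 0 z00) (mz' 0 z00).
apply: (le_trans L).
have [E|ne] := eqVneq (X 0 y) (X 0 y').
  by rewrite E subrr normr0.
have phi0 : 0 < X 0 y - X 0 y' by rewrite subr_gt0 lt_neqAle eq_sym ne.
have Dphi z := is_deriveB (dXx z y) (dXx z y').
(* The order of the two points is kept, since a zero of the difference would contradict
   injectivity. *)
have phipos z : 0 <= z <= x -> 0 < X z y - X z y'.
  apply: (@pos_no_first_zero _ (fun z => X z y - X z y') 0 x) => //.
    exact: continuous_subspaceT (derive_continuous Dphi).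
  move=> w wi _ _; apply/eqP => /subr0_eq /R4_X_inj E.
  have [i1 i2] : R4 psi1 psi2 (w, y) /\ R4 psi1 psi2 (w, y').
    by split; apply: inside_R4; [apply: ins|apply: ins']; lra.
  by move/eqP: ne; rewrite (E i1 i2).
have : X 0 y - X 0 y' <= X x y - X x y'.
  apply: (derive_homo x0 Dphi) => z zi; have zi' : 0 <= z <= x by lra.
  have zi1 : 0 < z < 1 by lra.
  rewrite !Xx_fold//; [|exact: ins'|exact: ins].
  have := phipos _ zi'; have := mz _ zi'; have := mz' _ zi'.
  set a := s z y; set b := s z y' => b1 a1 ab.
  have {}ab : b <= a by rewrite ler_pM2l ?mulr_gt0//; lra.
  have da : 0 < 1 + a ^+ 2 by rewrite ltr_pwDl// sqr_ge0.
  have db : 0 < 1 + b ^+ 2 by rewrite ltr_pwDl// sqr_ge0.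
  have -> : lam * a / (1 + a ^+ 2) - lam * b / (1 + b ^+ 2) =
      lam * ((a - b) * (1 - a * b)) / ((1 + a ^+ 2) * (1 + b ^+ 2)).
    by field; rewrite !lt0r_neq0.
  rewrite divr_ge0 ?mulr_ge0 ?(ltW lam0) ?(ltW da) ?(ltW db) ?subr_ge0//.
  by nra.
by rewrite !ger0_norm ?(ltW phi0) ?(ltW (phipos _ _))//; lra.
Qed.

(** Lets two points on different vertical lines be compared: the left one is moved right onto the
    line of the other, and stays on its side of q. *)
Lemma fold_two_points x x' y y' : x <= x' ->
  R4 psi1 psi2 (x, y) -> R4 psi1 psi2 (x', y') ->
  Y x y <= sig^-1 -> (y <= t /\ y' <= t) \/ (t <= y /\ t <= y') ->
  [/\ R4 psi1 psi2 (x', y), Y x' y <= sig^-1, `|X x' y - X x y| <= lam * (x' - x) &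
     0 <= (X x y - q) * (X x' y' - q)].
Proof.
move=> xx i i' low side; have [xi _] := (R4_itv x y).1 i; have [xi' _] := (R4_itv x' y').1 i'.
have [x0 x1'] : 0 <= x /\ x' <= 1 by lra.
have ins z : x <= z <= x' -> inside z y by move=> zi; apply: (fold_right i) => //; lra.
have seg z : x <= z <= x' -> [/\ Y z y <= Y x y, (X x y - q) ^+ 2 <= (X z y - q) ^+ 2 &
    `|X z y - X x y| <= lam * (z - x)].
  by move=> zi; apply: fold_segment => //; [lra|lra|move=> w wi; apply: ins; lra].
have xx' : x <= x' <= x' by rewrite xx lexx.
have [s1 s2 s3] := seg _ xx'; have ix' := inside_R4 (ins _ xx').
split => //; first exact: le_trans s1 low.
have sgn : 0 <= (X x' y - q) * (X x' y' - q).
  case: (leP y y') => [yy|/ltW yy]; case: side => -[yt yt'].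
  - by rewrite mulrC; have [|] := @fold_side x' y y' ix'; [right; lra|].
  - by have [|] := @fold_side x' y' y i'; [left; lra|].
  - by have [|] := @fold_side x' y' y i'; [right; lra|].
  - by rewrite mulrC; have [|] := @fold_side x' y y' ix'; [left; lra|].
have [->|a0] := eqVneq (X x y) q; first by rewrite subrr mul0r.
have a2 : 0 < (X x y - q) ^+ 2 by rewrite exprn_even_gt0// subr_eq0.
(* (X - q)^2 does not decrease to the right, so X cannot reach q once it differs from it. *)
have ab : 0 < (X x y - q) * (X x' y - q).
  have Dx (z : R) : is_derive z (1 : R) (fun z => (X x y - q) * (X z y - q))
      ((X x y - q) *: (Xx z y - 0)).
    exact: (is_deriveZ _ (is_deriveB (dXx z y) (is_derive_cst q z (1 : R)))).
  apply: (@pos_no_first_zero _ (fun z => (X x y - q) * (X z y - q)) x x') => //.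
    exact: continuous_subspaceT (derive_continuous Dx).
  move=> z zi _ _; rewrite mulf_neq0 ?subr_eq0//; apply/eqP => E.
  have zi' : x <= z <= x' by lra.
  have [_ + _] := seg _ zi'; rewrite E subrr expr0n/=.
  by rewrite leNgt a2.
move: ab sgn; set a := _ - q; set b := X x' y - q; set d := _ - q => ab bd.
have b0 : b != 0 by apply: contraTneq ab => ->; rewrite mulr0 ltxx.
have : 0 <= (a * d) * b ^+ 2.
  by rewrite (_ : _ * _ = (a * b) * (b * d)); [rewrite mulr_ge0// ltW|ring].
by rewrite pmulr_lge0// exprn_even_gt0.
Qed.

End Fold.

(** * The affine strips *)

Section Strips.
Context {R : realType} {lam sig c q t b3 t3 : R} {psi1 psi2 : R -> R}
  {Psi f : R * R -> R * R}.
Implicit Types x y : R.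
Hypothesis H : horseshoe lam sig c q t b3 t3 psi1 psi2 Psi f.

Local Notation X x y := (f (x, y)).1.
Local Notation Y x y := (f (x, y)).2.
Local Notation Yy x y := (ddy (fun p => (f p).2) (x, y)).

Let C1X : C1_fun (fun p => (f p).1). Proof. by case: (hs_diffeo H) => -[[]]. Qed.
Let C1Y : C1_fun (fun p => (f p).2). Proof. by case: (hs_diffeo H) => -[_ []]. Qed.
Let lam0 : 0 < lam. Proof. by case/andP: (hs_lam H). Qed.
Let lam3 : lam < 1 / 3. Proof. by case/andP: (hs_lam H). Qed.
Let c0 : 0 < c. Proof. exact: hs_c H. Qed.
Let sig0 : 0 < sig. Proof. by have := hs_sig H; lra. Qed.
Let isig0 : 0 < sig^-1. Proof. by rewrite invr_gt0. Qed.
Let isig3 : sig^-1 < 1 / 3.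
Proof. by rewrite div1r ltf_pV2 ?posrE//; exact: hs_sig H. Qed.
Let strip3 : [/\ 1 / 3 <= b3, b3 < t3 & t3 <= 1].
Proof. by have [? /andP[? ?]] := hs_strip3 H. Qed.

Let basic : [/\ 0 < lam, lam < 1 / 3, 0 < sig, 0 < sig^-1 & sig^-1 < 1 / 3].
Proof. by split. Qed.

Let squareE x y : square (x, y) <-> 0 <= x <= 1 /\ 0 <= y <= 1.
Proof. by rewrite /square /= !in_itv. Qed.

Let dXy x y : is_derive y (1 : R) (fun y => X x y) (ddy (fun p => (f p).1) (x, y)).
Proof. exact: (@is_derive_ddy _ (fun p => (f p).1)). Qed.
Let dYy x y : is_derive y (1 : R) (fun y => Y x y) (Yy x y).
Proof. exact: (@is_derive_ddy _ (fun p => (f p).2)). Qed.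

Let cX x y : {for y, continuous (fun y => X x y)}.
Proof. by have C := derive_continuous (dXy x); exact: C. Qed.
Let cY x y : {for y, continuous (fun y => Y x y)}.
Proof. by have C := derive_continuous (dYy x); exact: C. Qed.

Lemma R1_map x y : 0 <= x <= 1 -> 0 <= y <= sig^-1 ->
  X x y = lam * x /\ Y x y = sig * y.
Proof.
move=> xi yi; have [l0 l3 s0 i0 i3] := basic; rewrite (hs_R1 H)//; split => /=; last by lra.
by apply/squareE; split => //; lra.
Qed.

Lemma R5_map x y : 0 <= x <= 1 -> bot5 sig <= y <= 1 ->
  X x y = lam * x + (1 - lam) /\ Y x y = sig * y - (sig - 1).
Proof.
rewrite /bot5 => xi yi; have [l0 l3 s0 i0 i3] := basic;
rewrite (hs_R5 H)//; split => /=; last by rewrite /bot5; lra.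
by apply/squareE; split => //; lra.
Qed.

(** Each bound is forced. Otherwise the images of R1 and R3 would meet, or points of R2 just below
    R3 would be mapped into the square, or gap points just above R3 would be mapped outside R2. *)
Lemma R3_map : exists u v : R, [/\ 2 * lam < u <= 1, v - sig * b3 = 1,
  sig^-1 < v - sig * t3 <= b3 &
  forall x y, 0 <= x <= 1 -> b3 <= y <= t3 -> X x y = u - lam * x /\ Y x y = v - sig * y].
Proof.
have [l0 l3 s0 i0 i3] := basic; have [u [v f3]] := hs_R3 H; have [b13 bt3 t31] := strip3.
have in3 x y : 0 <= x <= 1 -> b3 <= y <= t3 -> R3 b3 t3 (x, y).
  by move=> xi yi; split => //=; apply/squareE; split => //; lra.
have f3' x y : 0 <= x <= 1 -> b3 <= y <= t3 -> X x y = u - lam * x /\ Y x y = v - sig * y.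
  by move=> xi yi; rewrite f3//; exact: in3.
have sq3 x y : 0 <= x <= 1 -> b3 <= y <= t3 -> 0 <= u - lam * x <= 1 /\ 0 <= v - sig * y <= 1.
  move=> xi yi; have : square (f (x, y)).
    by apply: (hs_R3_image H); exists (x, y) => //; exact: in3.
  by rewrite f3; [move/squareE|exact: in3].
have x00 : 0 <= (0 : R) <= 1 by rewrite lexx ler01.
have x11 : 0 <= (1 : R) <= 1 by rewrite lexx ler01.
(* At the abscissa 1 / 2 the value u - lam / 2 of X is strictly between 0 and 1, which leaves room
   for small perturbations. *)
have h01 : 0 <= (1 / 2 : R) <= 1 by lra.
have [bb tt] : b3 <= b3 <= t3 /\ b3 <= t3 <= t3 by lra.
have sbt : sig * b3 < sig * t3 by rewrite ltr_pM2l.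
have [] := sq3 _ _ x11 bb; have [] := sq3 _ _ x00 tt; rewrite mulr0 mulr1 subr0 => u1 v1 u2 v2.
have [X3b Y3b] := f3' _ _ h01 bb; have [X3t Y3t] := f3' _ _ h01 tt.
have [p12 p2 p5] := hs_strip4 H h01; rewrite /bot5 in p5.
have gap y : t3 < y < psi1 (1 / 2) -> sig^-1 < Y (1 / 2) y < b3.
  move=> yi; have [|||[_ +] _ //] := hs_gaps H (p := (1 / 2, y)).
  - by apply/squareE; split => //; lra.
  - by move=> /=; rewrite /bot5; lra.
  - by case=> _ /=; lra.
exists u, v; split => //.
- rewrite (andP u1).2 andbT; rewrite ltNge; apply/negP => ul.
  (* If u <= 2 lam, this is the abscissa of a point of R1 with the same image as (1, b3). *)
  have k1 : 0 <= (u - lam) / lam <= 1.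
    by rewrite divr_ge0 ?ler_pdivrMr ?(ltW lam0)//=; lra.
  have k2 : 0 <= (v - sig * b3) / sig <= sig^-1.
    by rewrite divr_ge0 ?(ltW sig0) ?ler_pdivrMr ?mulVf ?gt_eqF//=; lra.
  have [E1 E2] := R1_map k1 k2; have [E3 E4] := f3' _ _ x11 bb.
  have /(hs_inj H)[_] : f ((u - lam) / lam, (v - sig * b3) / sig) = f (1, b3).
    apply: injective_projections; rewrite ?E1 ?E2 ?E3 ?E4.
      by field; rewrite gt_eqF.
    by field; rewrite gt_eqF.
  by move: k2; lra.
- apply/eqP; rewrite eq_le (andP v2).2 leNgt; apply/negP => v1'.
  have : \forall y \near b3, 0 < X (1 / 2) y < 1 /\ 0 < Y (1 / 2) y < 1.
    near=> y; split; apply/andP; split; near: y.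
    + by apply: (@near_gt _ (fun y => X (1 / 2) y)) => //; rewrite X3b; lra.
    + by apply: (@near_lt _ (fun y => X (1 / 2) y)) => //; rewrite X3b; lra.
    + by apply: (@near_gt _ (fun y => Y (1 / 2) y)) => //; rewrite Y3b; lra.
    + by apply: (@near_lt _ (fun y => Y (1 / 2) y)) => //; rewrite Y3b; lra.
  have ib : sig^-1 < b3 by lra.
  move=> /(near_left ib)[y /andP[y1 y2] Hy].
  have [|/andP[X0 X1] /andP[Y0 Y1]] := Hy y; first by rewrite lexx ltW.
  apply: (hs_R2 H (p := (1 / 2, y))).
    split; last exact/andP.
    by apply/squareE; rewrite (ltW (lt_trans i0 y1)) (ltW (lt_le_trans y2 _))//; lra.
  by rewrite (surjective_pairing (f _)); apply/squareE; rewrite !ltW.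
- apply/andP; split; rewrite ?ltNge ?leNgt; apply/negP => vt.
    (* Y has slope - sig on R3, hence a negative slope at t3 as well. If it were at most [sig^-1] at
       t3, it would remain so just above, on gap points. *)
    have Yyc : {for t3, continuous (fun y => Yy (1 / 2) y)}.
      by have C := @continuous_ddy_vertical _ _ (1 / 2) C1Y; exact: C.
    have Yy3 y : b3 < y < t3 -> Yy (1 / 2) y = - sig.
      move=> yi; have D1 := is_deriveZ sig (is_derive_id y (1 : R)).
      have : is_derive y (1 : R) (fun z => Y (1 / 2) z + sig * z) (Yy (1 / 2) y + sig).
        by apply: (is_derive_eq (is_deriveD (dYy (1 / 2) y) D1)); rewrite /GRing.scale/= mulr1.
      move/(@derive_near_cst _ _ _ v) => E.
      apply/eqP; rewrite -addr_eq0; apply/eqP/E.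
      have yI : y \in `]b3, t3[ by rewrite in_itv.
      near=> z; have : z \in `]b3, t3[ by near: z; exact: near_in_itvoo.
      rewrite in_itv/= => zi; have [|_ E2] := f3' _ z h01; first lra.
      by rewrite E2; ring.
    have Yyt : Yy (1 / 2) t3 < 0.
      rewrite ltNge; apply/negP => Yy0.
      have : \forall y \near t3, - sig < Yy (1 / 2) y.
        by apply: (near_gt Yyc); lra.
      move=> /(near_left bt3)[y yi Hy].
      have := Hy y; rewrite Yy3// ltxx lexx ltW; last by case/andP: yi.
      by move/(_ isT).
    have : \forall y \near t3, Yy (1 / 2) y < 0 by apply: (near_lt Yyc).
    move=> /(near_right p12)[y yi Hy]; have y3 := (andP yi).1.
    have Yle : Y (1 / 2) y <= Y (1 / 2) t3.
      apply: (derive_antihomo (ltW y3) (dYy (1 / 2))) => z /andP[z1 z2].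
      by apply/ltW/Hy; rewrite !ltW.
    have /andP[+ _] := gap y yi; apply/negP; rewrite -leNgt.
    by apply: (le_trans Yle); rewrite Y3t leNgt.
  have : \forall y \near t3, b3 < Y (1 / 2) y.
    by apply: (@near_gt _ (fun y => Y (1 / 2) y)) => //; rewrite Y3t.
  move=> /(near_right p12)[y yi Hy].
  have /andP[_] := gap y yi; apply/negP; rewrite -leNgt; apply/ltW/Hy.
  by case/andP: yi => y3 _; rewrite lexx ltW.
Unshelve. all: by end_near. Qed.
End Strips.

(** * Square-root coordinates *)

Section SqrtDist.
Context {R : realType}.
Implicit Types a b k : R.

Definition sdist a b : R := `|Num.sqrt a - Num.sqrt b|.

Lemma dist_sdist a b : 0 <= a -> 0 <= b ->
  `|a - b| = sdist a b * (Num.sqrt a + Num.sqrt b).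
Proof.
move=> a0 b0; rewrite -[X in _ * X]ger0_norm ?addr_ge0 ?sqrtr_ge0// -normrM.
by rewrite -subr_sqr !sqr_sqrtr.
Qed.

Lemma sqrtr_le1 a : a <= 1 -> Num.sqrt a <= 1.
Proof. by rewrite -{2}sqrtr1; exact: ler_wsqrtr. Qed.

Lemma dist_le_sdist a b : 0 <= a <= 1 -> 0 <= b <= 1 -> `|a - b| <= 2 * sdist a b.
Proof.
move=> /andP[a0 a1] /andP[b0 b1]; rewrite dist_sdist// mulrC ler_wpM2r ?normr_ge0//.
have := sqrtr_le1 a1; have := sqrtr_le1 b1; lra.
Qed.

Lemma sdist_le_dist k a b : 0 <= k -> k ^+ 2 <= a -> k ^+ 2 <= b ->
  2 * k * sdist a b <= `|a - b|.
Proof.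
move=> k0 ka kb.
have k2 : 0 <= k ^+ 2 by rewrite sqr_ge0.
rewrite dist_sdist; [|exact: le_trans ka|exact: le_trans kb].
rewrite [leRHS]mulrC ler_wpM2r ?normr_ge0// mulr_natl mulr2n lerD//.
  by rewrite -(ger0_norm k0) -sqrtr_sqr ler_wsqrtr.
by rewrite -(ger0_norm k0) -sqrtr_sqr ler_wsqrtr.
Qed.

Lemma sdistZ k a b : 0 <= k -> sdist (k * a) (k * b) = Num.sqrt k * sdist a b.
Proof.
by move=> k0; rewrite /sdist !sqrtrM// -mulrBr normrM ger0_norm ?sqrtr_ge0.
Qed.

Lemma sdist_le1 a b : 0 <= a <= 1 -> 0 <= b <= 1 -> sdist a b <= 1.
Proof.
move=> /andP[a0 a1] /andP[b0 b1].
have := sqrtr_le1 a1; have := sqrtr_le1 b1.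
have := sqrtr_ge0 a; have := sqrtr_ge0 b.
by rewrite /sdist ler_norml; lra.
Qed.

Lemma sdistC a b : sdist a b = sdist b a.
Proof. exact: distrC. Qed.

(** The square root of a + b is the Euclidean norm of (sqrt a, sqrt b): this is the reverse triangle
    inequality, followed by the bound of that norm by the sum of the coordinates. *)
Lemma sdistD a b a' b' : 0 <= a -> 0 <= b -> 0 <= a' -> 0 <= b' ->
  sdist (a + b) (a' + b') <= sdist a a' + sdist b b'.
Proof.
move=> a0 b0 a'0 b'0; rewrite /sdist.
set A := Num.sqrt (a + b); set A' := Num.sqrt (a' + b').
have : A ^+ 2 = Num.sqrt a ^+ 2 + Num.sqrt b ^+ 2 by rewrite !sqr_sqrtr ?addr_ge0.
have : A' ^+ 2 = Num.sqrt a' ^+ 2 + Num.sqrt b' ^+ 2 by rewrite !sqr_sqrtr ?addr_ge0.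
have := sqrtr_ge0 (a + b); have := sqrtr_ge0 (a' + b'); rewrite -/A -/A'.
move: (sqrtr_ge0 a) (sqrtr_ge0 b) (sqrtr_ge0 a') (sqrtr_ge0 b').
move: A A' (Num.sqrt a) (Num.sqrt b) (Num.sqrt a') (Num.sqrt b').
move=> A A' p r p' r' p0 r0 p'0 r'0 A'0 A0 EA' EA.
have CS : p * p' + r * r' <= A * A'.
  rewrite -ler_sqr ?nnegrE ?addr_ge0 ?mulr_ge0//.
  rewrite exprMn EA EA' -subr_ge0.
  rewrite (_ : _ - _ = (p * r' - r * p') ^+ 2) ?sqr_ge0//; ring.
rewrite -ler_sqr ?nnegrE ?addr_ge0// real_normK ?num_real//.
rewrite [leRHS]sqrrD !real_normK ?num_real// -normrM.
have N := normr_ge0 ((p - p') * (r - r')).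
have -> : (A - A') ^+ 2 = A ^+ 2 + A' ^+ 2 - 2 * (A * A') by ring.
rewrite EA EA'.
have -> : (p - p') ^+ 2 = p ^+ 2 + p' ^+ 2 - 2 * (p * p') by ring.
have -> : (r - r') ^+ 2 = r ^+ 2 + r' ^+ 2 - 2 * (r * r') by ring.
by rewrite mulr2n; lra.
Qed.

End SqrtDist.

Lemma sqrtr_le_quarter {R : realType} (k : R) : k <= 1 / 16 -> Num.sqrt k <= 1 / 4.
Proof.
move=> k16; have -> : 1 / 4 = Num.sqrt (1 / 16) :> R.
  rewrite (_ : 1 / 16 = (1 / 4) ^+ 2 :> R); last by field.
  by rewrite sqrtr_sqr ger0_norm// divr_ge0.
exact: ler_wsqrtr.
Qed.

Lemma sdist_le_dist_far {R : realType} (a b : R) :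
  1 / 3 <= a -> 1 / 3 <= b -> sdist a b <= `|a - b|.
Proof.
move=> ha hb; have h0 : 0 <= 1 / 2 :> R by rewrite divr_ge0.
have q4 : (1 / 2) ^+ 2 <= 1 / 3 :> R by lra.
by have := sdist_le_dist h0 (le_trans q4 ha) (le_trans q4 hb); lra.
Qed.

(** * Affine contractions in square-root coordinates *)

Section Contractions.
Context {R : realType}.
Implicit Types a b A B k M : R.

Lemma sdist_scale k a b M : 0 <= k <= 1 / 16 -> sdist a b <= M ->
  sdist (k * a) (k * b) <= M / 2.
Proof.
move=> /andP[k0 k16] ab; rewrite sdistZ//.
have : Num.sqrt k * sdist a b <= 1 / 4 * M.
  by rewrite ler_pM ?sqrtr_ge0 ?normr_ge0// sqrtr_le_quarter.
have : 0 <= M by apply: le_trans ab; exact: normr_ge0.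
by lra.
Qed.

Lemma sdist_scale_far k a b A B M : 0 <= k <= 1 / 16 -> 1 / 3 <= A -> 1 / 3 <= B ->
  `|A - B| = k * `|a - b| -> `|a - b| <= 2 * M -> sdist A B <= M / 2.
Proof.
move=> /andP[k0 k16] A3 B3 E ab; apply: (le_trans (sdist_le_dist_far A3 B3)).
have : k * `|a - b| <= 1 / 16 * (2 * M) by rewrite ler_pM.
have := normr_ge0 (a - b); rewrite E; lra.
Qed.

(** For an image strip possibly close to 0, but at distance at least k: there sqrt A + sqrt B >= 2
    sqrt k, so the factor k is replaced by sqrt k <= 1 / 4. *)
Lemma sdist_scale_shift k a b A B M : 0 < k <= 1 / 16 -> k <= A -> k <= B ->
  `|A - B| = k * `|a - b| -> `|a - b| <= 2 * M -> sdist A B <= M / 2.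
Proof.
move=> /andP[k0 k16]; have ks : Num.sqrt k ^+ 2 = k by rewrite sqr_sqrtr// ltW.
rewrite -{1 2}ks => kA kB E ab.
have := sdist_le_dist (sqrtr_ge0 k) kA kB; rewrite E.
have : k * `|a - b| <= k * (2 * M) by rewrite ler_pM2l.
move=> /[swap]/le_trans/[apply]; rewrite -{2}ks.
have -> : Num.sqrt k ^+ 2 * (2 * M) = 2 * Num.sqrt k * (Num.sqrt k * M) by ring.
rewrite ler_pM2l ?mulr_gt0 ?sqrtr_gt0//.
have M0 : 0 <= M by have := normr_ge0 (a - b); lra.
have := ler_wpM2r M0 (sqrtr_le_quarter k16); lra.
Qed.

End Contractions.

(** * Cross maps *)

Definition reg_lo {R : realType} (b3 t : R) (i : 'I_3) : R :=
  match val i with 0%N => 0 | 1%N => b3 | _ => t end.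

Definition reg_hi {R : realType} (sig t : R) (i : 'I_3) : R :=
  match val i with 0%N => sig^-1 | 1%N => t | _ => 1 end.

(* The two branches of the fold meet on the line y = t, shared by the regions
   1 and 2. *)
Definition reg {R : realType} (sig b3 t : R) (i : 'I_3) (y : R) : bool :=
  reg_lo b3 t i <= y <= reg_hi sig t i.

Section Coding.
Context {R : realType} {lam sig c q t b3 t3 : R} {psi1 psi2 : R -> R}
  {Psi f : R * R -> R * R}.
Implicit Types x y : R.
Hypothesis H : horseshoe lam sig c q t b3 t3 psi1 psi2 Psi f.

Local Notation X x y := (f (x, y)).1.
Local Notation Y x y := (f (x, y)).2.
Local Notation reg := (reg sig b3 t).

Lemma parameter_bounds : [/\ 0 < lam, 0 < sig, 0 < sig^-1, sig^-1 < 1 / 3 &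
  [/\ 1 / 3 <= b3, b3 < t3, t3 < t, t < bot5 sig & bot5 sig < 1]].
Proof.
have [/andP[l0 l3] s3] := (hs_lam H, hs_sig H).
have [b13 /andP[bt t31]] := hs_strip3 H.
have x00 : 0 <= (0 : R) <= 1 by rewrite lexx ler01.
have [p1 p2 p5] := hs_strip4 H x00.
have [/(R4_itv H)[_ ti] _] := hs_T H.
have s0 : 0 < sig by lra.
have i0 : 0 < sig^-1 by rewrite invr_gt0.
split => //; first by rewrite div1r ltf_pV2 ?posrE.
by split => //; [lra|lra|rewrite /bot5; lra].
Qed.

Lemma reg_itv i y : reg i y -> 0 <= y <= 1.
Proof.
have [l0 s0 i0 i3 [b1 b2 b4 b5 b6]] := parameter_bounds.
by rewrite /reg /reg_lo /reg_hi; case: (val i) => [|[|k]]; lra.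
Qed.

Lemma reg_pos i y : i != ord0 -> reg i y -> b3 <= y <= 1.
Proof.
have [l0 s0 i0 i3 [b1 b2 b4 b5 b6]] := parameter_bounds.
by rewrite /reg /reg_lo /reg_hi; case: i => -[//|[|k]] ? _ /=; lra.
Qed.

(** The other points above b3 have higher images: those of R3 by [R3_map], those of R5 because their
    images start at the height 1 / 3, gap points by assumption. *)
Lemma low_image_fold x y : 0 <= x <= 1 -> b3 <= y <= 1 -> Y x y <= sig^-1 ->
  R4 psi1 psi2 (x, y).
Proof.
move=> xi yi low; have [l0 s0 i0 i3 [b1 b2 b4 b5 b6]] := parameter_bounds.
have [u [v [_ vb vt f3]]] := R3_map H.
have [yt|ty] := leP y t3.
  have [|_ E] := f3 x y xi; first lra.
  by have := ler_wpM2l (ltW s0) yt; lra.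
have [y5|y5] := leP (bot5 sig) y.
  have [|_ E] := R5_map H (y := y) xi; first lra.
  have : sig * bot5 sig <= sig * y by rewrite ler_pM2l.
  have -> : sig * bot5 sig = sig - 2 / 3 by rewrite /bot5; field; rewrite gt_eqF.
  by lra.
apply: contrapT => not4; have [||//|_ /=] := hs_gaps H (p := (x, y)).
- by rewrite /square/= !in_itv/=; split => //; lra.
- by move=> /=; lra.
- by lra.
Qed.

(** On the part of R4 below t, (X - q)^2 and thus Y is largest on the bottom side, whose image is
    below b3; gap points are also mapped below b3. *)
Lemma high_image_R3 x y : 0 <= x <= 1 -> b3 <= y <= t -> b3 <= Y x y -> y <= t3.
Proof.
move=> xi yi high; have [l0 s0 i0 i3 [b1 b2 b4 b5 b6]] := parameter_bounds.
rewrite leNgt; apply/negP => ty.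
have [in4|not4] := pselect (R4 psi1 psi2 (x, y)).
  have [_ yi4] := (R4_itv H x y).1 in4; have [? p12 ?] := hs_strip4 H xi.
  have b4' : R4 psi1 psi2 (x, psi1 x) by apply/(R4_itv H); split => //; rewrite lexx ltW.
  have [|_ D _] := fold_side H (z := y) b4'; first by right; lra.
  have [[[_ /= /andP[_ s1]] _] _] := hs_R4_sides H xi.
  move: s1 high; rewrite !(Y_graph H)//.
  have := ler_wpM2l (ltW (hs_c H)) D; lra.
have [||//|[_ /= /andP[_ ?]] _] := hs_gaps H (p := (x, y)).
- by rewrite /square/= !in_itv/=; split => //; lra.
- by move=> /=; lra.
- by lra.
Qed.

Lemma high_image_R5 x y : 0 <= x <= 1 -> t <= y <= 1 -> b3 <= Y x y -> bot5 sig <= y.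
Proof.
move=> xi yi high; have [l0 s0 i0 i3 [b1 b2 b4 b5 b6]] := parameter_bounds.
rewrite leNgt; apply/negP => ty.
have [in4|not4] := pselect (R4 psi1 psi2 (x, y)).
  have [_ yi4] := (R4_itv H x y).1 in4; have [? p12 ?] := hs_strip4 H xi.
  have b4' : R4 psi1 psi2 (x, psi2 x) by apply/(R4_itv H); split => //; rewrite lexx ltW.
  have [|_ D _] := fold_side H (z := y) b4'; first by left; lra.
  have [_ [[_ /= /andP[_ s1]] _]] := hs_R4_sides H xi.
  move: s1 high; rewrite !(Y_graph H)//.
  have := ler_wpM2l (ltW (hs_c H)) D; lra.
have [||//|[_ /= /andP[_ ?]] _] := hs_gaps H (p := (x, y)).
- by rewrite /square/= !in_itv/=; split => //; lra.
- by move=> /=; lra.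
- by lra.
Qed.

Lemma reg_exists x y : 0 <= x <= 1 -> 0 <= y <= 1 -> square (f (x, y)) ->
  exists i, reg i y.
Proof.
move=> xi yi sq; have [l0 s0 i0 i3 [b1 b2 b4 b5 b6]] := parameter_bounds.
have [ys|ys] := leP y sig^-1; first by exists ord0; rewrite /reg /reg_lo /reg_hi /=; lra.
have [yb|yb] := ltP y b3.
  exfalso; apply: (hs_R2 H (p := (x, y))) => //.
  split; first by rewrite /square/= !in_itv.
  by move=> /=; lra.
have [yt|yt] := leP y t; first by
  exists (Ordinal (isT : (1 < 3)%N)); rewrite /reg /reg_lo /reg_hi /=; lra.
by exists ord_max; rewrite /reg /reg_lo /reg_hi /=; lra.
Qed.

End Coding.

(** * Solvability and contraction of one cross map *)

Section Steps.
Context {R : realType} {lam sig c q t b3 t3 : R} {psi1 psi2 : R -> R}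
  {Psi f : R * R -> R * R}.
Implicit Types x y M : R.
Hypothesis H : horseshoe lam sig c q t b3 t3 psi1 psi2 Psi f.
Local Notation X x y := (f (x, y)).1.
Local Notation Y x y := (f (x, y)).2.
Local Notation reg := (reg sig b3 t).

(** Bounds the distance to q of the low images of the fold. As q > 2 / 3, the bounds on m put these
    images at abscissas between 1 / 3 and 1. *)
Variable m : R.
Hypothesis c_large : 16 <= c.
Hypothesis lam_small : lam <= 1 / 16.
Hypothesis isig_small : sig^-1 <= 1 / 16.
Hypothesis m_pos : 0 < m.
Hypothesis m_small : m <= 1 / 3.
Hypothesis m_right : m <= 1 - q.
Hypothesis fold_narrow : sig^-1 + lam <= c * m ^+ 2.
Hypothesis fold_expand : forall x y y', R4 psi1 psi2 (x, y) -> R4 psi1 psi2 (x, y') ->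
  Y x y <= sig^-1 -> Y x y' <= sig^-1 -> sig / 2 * `|y - y'| <= `|X x y - X x y'|.

Lemma fold_image_itv x y : R4 psi1 psi2 (x, y) -> Y x y <= sig^-1 ->
  1 / 3 <= X x y <= 1.
Proof.
move=> in4 low; have [l0 s0 i0 i3 _] := parameter_bounds H.
have [xi _] := (R4_itv H x y).1 in4; have /andP[q1 q2] := hs_q H.
have : c * (X x y - q) ^+ 2 <= c * m ^+ 2.
  have := Y_graph H in4; have : lam * x <= lam * 1 by rewrite ler_pM2l//; lra.
  by move: low fold_narrow; lra.
rewrite ler_pM2l ?(hs_c H)// -(real_normK (num_real (X x y - q))).
rewrite ler_pXn2r ?nnegrE ?(ltW m_pos)// ler_norml.
by move: m_small m_right; lra.
Qed.

(** The affine branches are inverted by formula. On the fold the intermediate value theorem applies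
    between y = t, where Y = - lam x <= 0, and a side of R4, where Y > [sig^-1]. *)
Lemma step_solve x i j Y0 : 0 <= x <= 1 -> reg j Y0 ->
  exists y, [/\ reg i y, Y x y = Y0 & 0 <= X x y <= 1].
Proof.
move=> xi jY; have [l0 s0 i0 i3 [b1 b2 b4 b5 b6]] := parameter_bounds H.
have l1 := lam_small; have Yi := reg_itv H jY.
have lx0 : 0 <= lam * x by rewrite mulr_ge0 ?(ltW l0)//; lra.
have lx1 : lam * x <= lam * 1 by rewrite ler_pM2l//; lra.
have [u [v [uu vb vt f3]]] := R3_map H.
have [->|i_neq0] := eqVneq i ord0.
  have yi : 0 <= Y0 / sig <= sig^-1.
    rewrite divr_ge0 ?(ltW s0)//=; last lra.
    by rewrite ler_pdivrMr// mulVf ?gt_eqF//; lra.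
  have [E1 E2] := R1_map H xi yi; exists (Y0 / sig).
  rewrite E1 E2 /reg /reg_lo /reg_hi /=; split => //.
    by field; rewrite gt_eqF.
  by lra.
have [j0|j_neq0] := eqVneq j ord0; last first.
  have Yb := reg_pos H j_neq0 jY.
  have [->|->] : i = Ordinal (isT : (1 < 3)%N) \/ i = ord_max.
    by case: i i_neq0 => -[|[|[|//]]] ? //= _; [left|right]; exact/val_inj.
  - have yi : b3 <= (v - Y0) / sig <= t3.
      by rewrite ler_pdivlMr// ler_pdivrMr//; lra.
    have [E1 E2] := f3 _ _ xi yi; exists ((v - Y0) / sig); rewrite E1 E2 /reg /reg_lo /reg_hi /=.
    split; [lra| |lra].
    by field; rewrite gt_eqF.
  - have yi : bot5 sig <= (Y0 + (sig - 1)) / sig <= 1.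
      rewrite ler_pdivlMr// ler_pdivrMr// /bot5.
      rewrite (_ : (1 - 2 / 3 / sig) * sig = sig - 2 / 3); first lra.
      by field; rewrite gt_eqF.
    have [E1 E2] := R5_map H xi yi; exists ((Y0 + (sig - 1)) / sig).
    rewrite E1 E2 /reg /reg_lo /reg_hi /=; split; [lra| |lra].
    by field; rewrite gt_eqF.
move: jY; rewrite j0 /reg /reg_lo /reg_hi /= => Ylow.
have [p1 p2 p5] := hs_strip4 H xi; have [tin tq] := fold_tip H xi.
have [_ /andP[t1 t2]] := tin.
have [[[_ /= /andP[s1 _]] _] [[_ /= /andP[s2 _]] _]] := hs_R4_sides H xi.
have YT : Y x t <= 0 by rewrite (Y_graph H (inside_R4 H tin)) tq subrr expr0n/= mulr0; lra.
have Yc (a b : R) : {within `[a, b], continuous (fun y => Y x y)}.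
  apply: continuous_subspaceT.
  have C1Y : C1_fun (fun p => (f p).2) by case: (hs_diffeo H) => -[_ []].
  exact: derive_continuous (fun y => is_derive_ddy (g := fun p => (f p).2) x y C1Y).
have X01 y : psi1 x <= y <= psi2 x -> Y x y = Y0 -> 0 <= X x y <= 1.
  move=> yi E; have := @fold_image_itv x y; rewrite E => K.
  suff : 1 / 3 <= X x y <= 1 by lra.
  by apply: K; [apply/(R4_itv H)|lra].
have [->|->] : i = Ordinal (isT : (1 < 3)%N) \/ i = ord_max.
  by case: i i_neq0 => -[|[|[|//]]] ? //= _; [left|right]; exact/val_inj.
- have [|y] := IVT (v := Y0) (ltW t1) (Yc _ _).
    by rewrite ge_min le_max; apply/andP; split; apply/orP; [right|left]; lra.
  rewrite in_itv/= => yi E; exists y; split => //; first by rewrite /reg /reg_lo /reg_hi /=; lra.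
  by apply: X01 => //; lra.
- have [|y] := IVT (v := Y0) (ltW t2) (Yc _ _).
    by rewrite ge_min le_max; apply/andP; split; apply/orP; [left|right]; lra.
  rewrite in_itv/= => yi E; exists y; split => //; first by rewrite /reg /reg_lo /reg_hi /=; lra.
  by apply: X01 => //; lra.
Qed.

Lemma step_fold x y x' y' M : R4 psi1 psi2 (x, y) -> R4 psi1 psi2 (x', y') ->
  0 <= Y x y <= sig^-1 -> 0 <= Y x' y' <= sig^-1 ->
  (y <= t /\ y' <= t) \/ (t <= y /\ t <= y') ->
  sdist x x' <= M -> sdist (Y x y) (Y x' y') <= M ->
  sdist (X x y) (X x' y') <= M / 2 /\ sdist y y' <= M / 2.
Proof.
wlog xx : x y x' y' / x <= x'.
  move=> W i i' l l' sd dx dy; have [xx|/ltW xx] := leP x x'; first exact: W.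
  by rewrite sdistC (sdistC y); apply: W => //; rewrite 1?sdistC//; tauto.
move=> i i' l l' sd dx dy; have [l0 s0 i0 i3 [b1 b2 b4 b5 b6]] := parameter_bounds H.
have [xi yi] := (R4_itv H x y).1 i; have [xi' yi'] := (R4_itv H x' y').1 i'.
have [p1 p2 p5] := hs_strip4 H xi; have [p1' p2' p5'] := hs_strip4 H xi'.
have [|ix' lx' dX sgn] := fold_two_points H xx i i' _ sd; first lra.
have x01 : 0 <= x <= 1 by []; have x01' : 0 <= x' <= 1 by [].
have Mdx := dist_le_sdist x01 x01'.
have M0 : 0 <= M by apply: le_trans dx; exact: normr_ge0.
have sl := sqrtr_le_quarter lam_small; have sl0 := sqrtr_ge0 lam.
have X4 : 1 / 3 <= X x y <= 1 by apply: fold_image_itv => //; lra.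
have X4' : 1 / 3 <= X x' y' <= 1 by apply: fold_image_itv => //; lra.
(* The graph condition reads sqrt (Y + lam x) = sqrt c |X - q|. The left side varies by at most M +
   M / 4, and sqrt c >= 4. *)
have dXX : `|X x y - X x' y'| <= 5 / 16 * M.
  have root w v (iw : R4 psi1 psi2 (w, v)) :
      Num.sqrt (Y w v + lam * w) = Num.sqrt c * `|X w v - q|.
    rewrite (Y_graph H iw) subrK sqrtrM ?(ltW (hs_c H))//.
    by rewrite sqrtr_sqr.
  have c4 : 4 <= Num.sqrt c.
    have -> : 4 = Num.sqrt (4 ^+ 2) :> R by rewrite sqrtr_sqr ger0_norm.
    by apply: ler_wsqrtr; move: c_large; lra.
  have : sdist (Y x y + lam * x) (Y x' y' + lam * x') <= 5 / 4 * M.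
    have [Yp Yp'] := ((andP l).1, (andP l').1).
    have lx : 0 <= lam * x by rewrite mulr_ge0 ?(ltW l0)// (andP xi).1.
    have lxx' : 0 <= lam * x' by rewrite mulr_ge0 ?(ltW l0)// (andP xi').1.
    apply: (le_trans (sdistD Yp lx Yp' lxx')).
    rewrite (sdistZ _ _ (ltW l0)).
    have : Num.sqrt lam * sdist x x' <= 1 / 4 * M by rewrite ler_pM// normr_ge0.
    by lra.
  rewrite /sdist !root// -mulrBr normrM (ger0_norm (sqrtr_ge0 c)).
  have -> : `| `|X x y - q| - `|X x' y' - q| | = `|X x y - X x' y'|.
    rewrite (_ : X x y - X x' y' = (X x y - q) - (X x' y' - q)); last by ring.
    move: sgn; move: (X x y - q) (X x' y' - q) => a b.
    have [a0|a0|a0] := ltrgt0P a; last by rewrite a0 !sub0r !normrN normr_id.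
      by rewrite pmulr_rge0// => b0; rewrite (ger0_norm b0).
    rewrite nmulr_rge0// => b0; rewrite (ler0_norm b0) -normrN.
    by congr `| _ |; ring.
  have := normr_ge0 (X x y - X x' y'); set d := `|_| => d0 K.
  have : 4 * d <= Num.sqrt c * d by rewrite ler_wpM2r.
  by lra.
have dxx : `|x - x'| <= 2 * M by lra.
(* Replacing (x, y) by (x', y) changes X by at most lam (x' - x); then the expansion applies on a
   single vertical line, and sig >= 16. *)
have dyy : `|y - y'| <= M / 2.
  have := fold_expand ix' i' lx' _.
  have -> : X x' y - X x' y' = (X x' y - X x y) + (X x y - X x' y') by ring.
  move=> /(_ (andP l').2) /le_trans/(_ (ler_normD _ _)) E.
  have : lam * (x' - x) <= 1 / 16 * (2 * M).
    rewrite ler_pM ?(ltW l0) ?subr_ge0//.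
    by apply: le_trans dxx; rewrite distrC ler_norm.
  have : 16 * `|y - y'| <= sig * `|y - y'|.
    rewrite ler_wpM2r//; have : sig^-1 * (16 * sig) <= 1 / 16 * (16 * sig).
      by rewrite ler_wpM2r// mulr_ge0// ltW.
    by rewrite mulrCA mulVf ?gt_eqF//; lra.
  by have := normr_ge0 (y - y'); lra.
split.
- apply: (le_trans (sdist_le_dist_far (andP X4).1 (andP X4').1)).
  by apply: (le_trans dXX); lra.
- have y3 : 1 / 3 <= y by lra.
  have y3' : 1 / 3 <= y' by lra.
  exact: le_trans (sdist_le_dist_far y3 y3') dyy.
Qed.

(** The symbols determine the branch: R1 if i = 0, the fold if i > 0 and j = 0, and otherwise R3 for
    i = 1 and R5 for i = 2. *)
Lemma step_contract x y x' y' i j M :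
  0 <= x <= 1 -> 0 <= x' <= 1 -> reg i y -> reg i y' ->
  reg j (Y x y) -> reg j (Y x' y') ->
  sdist x x' <= M -> sdist (Y x y) (Y x' y') <= M ->
  sdist (X x y) (X x' y') <= M / 2 /\ sdist y y' <= M / 2.
Proof.
move=> xi xi' ry ry' rY rY' dx dY.
have [l0 s0 i0 i3 [b1 _ b4 _ _]] := parameter_bounds H.
have lam16 : 0 < lam <= 1 / 16 by rewrite l0 lam_small.
have lam16' : 0 <= lam <= 1 / 16 by rewrite ltW ?lam_small.
have isig16 : 0 <= sig^-1 <= 1 / 16 by rewrite ltW ?isig_small.
have dxx : `|x - x'| <= 2 * M.
  by apply: (le_trans (dist_le_sdist xi xi')); rewrite ler_pM2l.
have dYY : `|Y x y - Y x' y'| <= 2 * M.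
  by apply: (le_trans (dist_le_sdist (reg_itv H rY) (reg_itv H rY'))); rewrite ler_pM2l.
have [i_eq0|i_neq0] := eqVneq i ord0.
  move: ry ry'; rewrite i_eq0 /reg /reg_lo /reg_hi /= => ry ry'.
  have [-> E2] := R1_map H xi ry; have [-> E2'] := R1_map H xi' ry'.
  split; first exact: sdist_scale.
  rewrite -[y](mulKf (lt0r_neq0 s0)) -[y'](mulKf (lt0r_neq0 s0)) -E2 -E2'.
  exact: sdist_scale.
have y1 := reg_pos H i_neq0 ry; have y1' := reg_pos H i_neq0 ry'.
have Hi : i = Ordinal (isT : (1 < 3)%N) \/ i = ord_max.
  by case: i i_neq0 {ry ry'} => -[|[|[|//]]] ? //= _; [left|right]; exact/val_inj.
have [j_eq0|j_neq0] := eqVneq j ord0.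
  move: rY rY'; rewrite j_eq0 /reg /reg_lo /reg_hi /= => rY rY'.
  have i4 := low_image_fold H xi y1 (andP rY).2.
  have i4' := low_image_fold H xi' y1' (andP rY').2.
  apply: step_fold => //; move: ry ry'.
  by case: Hi => -> /andP[? ?] /andP[? ?]; [left|right].
have [Yb Yb'] := (andP (reg_pos H j_neq0 rY), andP (reg_pos H j_neq0 rY')).
have [y3 y3'] := (le_trans b1 (andP y1).1, le_trans b1 (andP y1').1).
have high : `|Y x y - Y x' y'| = sig * `|y - y'| -> sdist y y' <= M / 2.
  move=> E; apply: (sdist_scale_far isig16) dYY => //.
  by rewrite E mulKf// lt0r_neq0.
case: Hi => Ei; move: ry ry'; rewrite Ei /reg /reg_lo /reg_hi /= => ry ry'.
- have [u [v [/andP[ul u1] _ _ f3]]] := R3_map H.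
  have yt : b3 <= y <= t3 by rewrite (andP ry).1 (high_image_R3 H xi ry Yb.1).
  have yt' : b3 <= y' <= t3 by rewrite (andP ry').1 (high_image_R3 H xi' ry' Yb'.1).
  have [E1 E2] := f3 x y xi yt; have [E1' E2'] := f3 x' y' xi' yt'.
  (* The bound 2 lam < u keeps the image of R3 at distance at least lam from x = 0, as
     [sdist_scale_shift] requires. *)
  have far z : 0 <= z <= 1 -> lam <= u - lam * z.
    by move=> /andP[_ z1]; have := ler_wpM2l (ltW l0) z1; lra.
  split; last first.
    apply: high; rewrite E2 E2' (_ : _ - _ = - sig * (y - y')); last by ring.
    by rewrite normrM normrN (gtr0_norm s0).
  apply: (sdist_scale_shift lam16) dxx; [by rewrite E1 far|by rewrite E1' far|].
  rewrite E1 E1' (_ : _ - _ = - lam * (x - x')); last by ring.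
  by rewrite normrM normrN (gtr0_norm l0).
- have yt : bot5 sig <= y <= 1 by rewrite (andP ry).2 (high_image_R5 H xi ry Yb.1).
  have yt' : bot5 sig <= y' <= 1 by rewrite (andP ry').2 (high_image_R5 H xi' ry' Yb'.1).
  have [E1 E2] := R5_map H xi yt; have [E1' E2'] := R5_map H xi' yt'.
  have far z : 0 <= z <= 1 -> 1 / 3 <= lam * z + (1 - lam).
    by move=> /andP[z0 _]; have := mulr_ge0 (ltW l0) z0; move: lam_small; lra.
  split; last first.
    apply: high; rewrite E2 E2' (_ : _ - _ = sig * (y - y')); last by ring.
    by rewrite normrM (gtr0_norm s0).
  apply: (sdist_scale_far lam16') dxx; [by rewrite E1 far|by rewrite E1' far|].
  rewrite E1 E1' (_ : _ - _ = lam * (x - x')); last by ring.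
  by rewrite normrM (gtr0_norm l0).
Qed.

End Steps.

(** * Sequences of contracting cross maps *)

Section Geometric.
Context {R : realType}.
Implicit Types (a b C l : R) (n : nat) (u : nat -> R).

Lemma le_of_geometric a b C : (forall n, a <= b + C * 2 ^- n) -> a <= b.
Proof.
move=> ab; rewrite leNgt; apply/negP => ba.
have := ab (Num.bound (C / (a - b))); apply/negP; rewrite -ltNge.
have := upper_nthrootP (leqnn (Num.bound (C / (a - b)))).
set n := Num.bound _; have ab0 : 0 < a - b by rewrite subr_gt0.
rewrite ltr_pdivrMr// => Cn.
have : C * 2 ^- n < a - b by rewrite ltr_pdivrMr ?exprn_gt0// mulrC.
by lra.
Qed.

(** The intervals of radius 2 * 2 ^- n around u n are nested; the limit is the infimum of their
    right ends. *)
Lemma geometric_limit u : (forall n, `|u n.+1 - u n| <= 2 ^- n) -> exists l,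
  forall n, `|u n - l| <= 2 * 2 ^- n.
Proof.
move=> du; pose S := [set u n + 2 * 2 ^- n | n in setT].
have half n : 2 * 2 ^- n.+1 = 2 ^- n :> R.
  by rewrite exprS invfM mulrA divff ?mul1r// pnatr_eq0.
have inc n m : u n - 2 * 2 ^- n <= u (n + m)%N - 2 * 2 ^- (n + m)
    /\ u (n + m)%N + 2 * 2 ^- (n + m) <= u n + 2 * 2 ^- n.
  elim: m => [|m IH]; first by rewrite addn0; split.
  by rewrite addnS half; have := du (n + m)%N; rewrite ler_norml; move: IH; lra.
have lbS n : lbound S (u n - 2 * 2 ^- n).
  move=> _ [m _ <-]; have [_ +] := inc m n; have [+ _] := inc n m.
  have : 0 <= 2 ^- (n + m) :> R by rewrite invr_ge0 exprn_ge0.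
  by rewrite [in u (m + n)%N]addnC [in 2 ^- (m + n)]addnC; lra.
have S0 : S !=set0 by exists (u 0%N + 2 * 2 ^- 0); exists 0%N.
exists (inf S) => n; have low : u n - 2 * 2 ^- n <= inf S by apply: lb_le_inf.
have : inf S <= u n + 2 * 2 ^- n.
  apply: ge_inf; first by exists (u 0%N - 2 * 2 ^- 0); exact: lbS.
  by exists n.
by rewrite ler_norml; lra.
Qed.

(* d k and e k measure the distance between the stable, respectively unstable,
   coordinates at time k of two orbits: d is contracted in forward time, e in
   backward time. *)
Lemma two_sided_decay (d e : int -> R) n :
  (forall k, d k <= 1) -> (forall k, e k <= 1) ->
  (forall k M, - n%:Z <= k < n%:Z -> d k <= M -> e (k + 1) <= M ->
    d (k + 1) <= M / 2 /\ e k <= M / 2) ->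
  d 0 <= 2 * 2 ^- n /\ e 0 <= 2 * 2 ^- n.
Proof.
move=> d1 e1 step.
(* Each halving costs one time at either end of the window. The pair d k, e (k + 1) is the input of
   the step at time k. *)
have P j : forall k : int, - n%:Z + j%:Z <= k -> k < n%:Z - j%:Z ->
    d k <= 2 ^- j /\ e (k + 1) <= 2 ^- j.
  elim: j => [|j IH] k k1 k2; first by rewrite expr0 invr1.
  have half : 2 ^- j / 2 = 2 ^- j.+1 :> R by rewrite exprS invfM mulrC.
  rewrite -half; split.
    have [||a b] := IH (k - 1); [lia|lia|].
    rewrite -[k in d k](subrK 1); apply: (step (k - 1) _ _ a b).1; lia.
  have [||a b] := IH (k + 1); [lia|lia|].
  by apply: (step (k + 1) _ _ a b).2; lia.
(* A window of radius n + 1 allows n halvings both at k = 0, which gives d 0, and at k = - 1, which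
   gives e 0; hence the factor 2. *)
case: n step P => [|n] step P; first by rewrite expr0 invr1; have := d1 0; have := e1 0; lra.
have half : 2 * 2 ^- n.+1 = 2 ^- n :> R.
  by rewrite exprS invfM mulrA divff ?mul1r// pnatr_eq0.
rewrite half; split.
  by apply: (P n 0 _ _).1; lia.
have [||_] := P n (-1); [lia|lia|].
by rewrite addNr.
Qed.

Lemma window_step (n : nat) (k : int) : - n%:Z <= k < n%:Z ->
  - n%:Z <= k <= n%:Z /\ - n%:Z <= k + 1 <= n%:Z.
Proof. by lia. Qed.
End Geometric.

(** * Orbits following a sequence of symbols *)

Section Symbolic.
Context {R : realType} {I : Type} (lo hi : I -> R) (f : R * R -> R * R).
Implicit Types (x y M : R) (i j : I) (xi : int -> I) (p : int -> R * R).

Local Notation reg i y := (lo i <= y <= hi i).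

Hypothesis lo_ge0 : forall i, 0 <= lo i.
Hypothesis lo_hi : forall i, lo i <= hi i.
Hypothesis hi_le1 : forall i, hi i <= 1.
Hypothesis solve : forall x i j (Y : R), 0 <= x <= 1 -> reg j Y ->
  exists y, [/\ reg i y, (f (x, y)).2 = Y & 0 <= (f (x, y)).1 <= 1].
Hypothesis contract : forall x y x' y' i j M,
  0 <= x <= 1 -> 0 <= x' <= 1 -> reg i y -> reg i y' ->
  reg j (f (x, y)).2 -> reg j (f (x', y')).2 ->
  sdist x x' <= M -> sdist (f (x, y)).2 (f (x', y')).2 <= M ->
  sdist (f (x, y)).1 (f (x', y')).1 <= M / 2 /\ sdist y y' <= M / 2.

Definition follows xi p := forall k,
  [/\ 0 <= (p k).1 <= 1, reg (xi k) (p k).2 & f (p k) = p (k + 1)].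

Let reg01 i y : reg i y -> 0 <= y <= 1.
Proof. by have := lo_ge0 i; have := hi_le1 i; lra. Qed.

Lemma follows_close xi xi' p p' n : follows xi p -> follows xi' p' ->
  (forall k, - n%:Z <= k <= n%:Z -> xi k = xi' k) ->
  sdist (p 0).1 (p' 0).1 <= 2 * 2 ^- n /\ sdist (p 0).2 (p' 0).2 <= 2 * 2 ^- n.
Proof.
move=> P P' agree.
apply: (@two_sided_decay _ (fun k => sdist (p k).1 (p' k).1) (fun k => sdist (p k).2 (p' k).2)).
- by move=> k; have [? _ _] := P k; have [? _ _] := P' k; exact: sdist_le1.
- move=> k; have [_ /reg01 ? _] := P k; have [_ /reg01 ? _] := P' k.
  exact: sdist_le1.
move=> k M kn dM eM.
have [x01 r E] := P k; have [x01' r' E'] := P' k.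
have [_ r1 _] := P (k + 1); have [_ r1' _] := P' (k + 1).
have [k1 k2] := window_step kn.
rewrite -(agree _ k1) in r'; rewrite -(agree _ k2) in r1'.
move: eM r1 r1'; rewrite -E -E'.
case: (p k) (p' k) x01 r x01' r' dM => [x y] [x' y'] /=.
move=> x01 r x01' r' dM eM r1 r1'.
exact: (contract x01 x01' r r' r1 r1').
Qed.

Lemma sdist_eq0 (a b : R) : 0 <= a -> 0 <= b -> sdist a b <= 0 -> a = b.
Proof.
move=> a0 b0 ab; apply/eqP; rewrite -subr_eq0 -normr_eq0 dist_sdist//.
by rewrite (le_anti (_ : sdist a b <= 0 <= sdist a b)) ?mul0r// ab normr_ge0.
Qed.

Lemma follows_unique xi p p' : follows xi p -> follows xi p' -> p 0 = p' 0.
Proof.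
move=> P P'; have C n := follows_close (n := n) P P' (fun _ _ => erefl).
have [/andP[x0 _] /reg01 /andP[y0 _] _] := P 0.
have [/andP[x0' _] /reg01 /andP[y0' _] _] := P' 0.
by apply: injective_projections; apply: sdist_eq0 => //;
  apply: (@le_of_geometric _ _ _ 2) => n; rewrite add0r; case: (C n).
Qed.

Lemma sdist_trans (b a d : R) : sdist a d <= sdist a b + sdist b d.
Proof. exact: ler_distD. Qed.

(* The points of the orbit are found by a contraction on sequences of pairs
   (x k, y k): x (k + 1) is recomputed from x k, and y k from y (k + 1). *)
Lemma follows_exists xi : exists p, follows xi p.
Proof.
(* b solves for the height y, given x, the height Y of the image and the two symbols; its value 0 on
   inadmissible data is arbitrary. *)
have /choice[b Hb] : forall z : (R * R) * (I * I), exists y,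
    0 <= z.1.1 <= 1 -> reg z.2.2 z.1.2 ->
    [/\ reg z.2.1 y, (f (z.1.1, y)).2 = z.1.2 & 0 <= (f (z.1.1, y)).1 <= 1].
  move=> [[x Y] [i j]] /=.
  have [[xx rr]|no] := pselect ((0 <= x <= 1) /\ reg j Y).
    by have [y Hy] := solve i xx rr; exists y.
  by exists 0 => xx rr; case: no.
pose B (s : int -> R * R) k := b (((s k).1, (s (k + 1)).2), (xi k, xi (k + 1))).
pose X (s : int -> R * R) k := (f ((s k).1, B s k)).1.
pose next (s : int -> R * R) k := (X s (k - 1), B s k).
pose V (s : int -> R * R) := forall k, 0 <= (s k).1 <= 1 /\ reg (xi k) (s k).2.
have BX s k : V s -> [/\ reg (xi k) (B s k), (f ((s k).1, B s k)).2 = (s (k + 1)).2 &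
    0 <= X s k <= 1].
  move=> Vs; apply: (Hb (((s k).1, (s (k + 1)).2), (xi k, xi (k + 1)))) => /=.
    by case: (Vs k).
  by case: (Vs (k + 1)).
have Vnext s : V s -> V (next s).
  by move=> Vs k; split; [case: (BX s (k - 1) Vs)|case: (BX s k Vs)].
have cnext s s' M : V s -> V s' ->
    (forall k, sdist (s k).1 (s' k).1 <= M /\ sdist (s k).2 (s' k).2 <= M) ->
    forall k, sdist (next s k).1 (next s' k).1 <= M / 2 /\
      sdist (next s k).2 (next s' k).2 <= M / 2.
  move=> Vs Vs' ss.
  have K k : sdist (X s k) (X s' k) <= M / 2 /\ sdist (B s k) (B s' k) <= M / 2.
    have [r E _] := BX s k Vs; have [r' E' _] := BX s' k Vs'.
    have [x1 _] := Vs k; have [x1' _] := Vs' k.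
    have [_ r1] := Vs (k + 1); have [_ r1'] := Vs' (k + 1).
    rewrite -E in r1; rewrite -E' in r1'.
    apply: (contract x1 x1' r r' r1 r1'); first by case: (ss k).
    by rewrite E E'; case: (ss (k + 1)).
  by move=> k; split; [case: (K (k - 1))|case: (K k)].
pose s0 (k : int) : R * R := (0, lo (xi k)).
pose S n := iter n next s0.
have VS n : V (S n).
  elim: n => [|n IH]; last exact: Vnext.
  by move=> k /=; rewrite !lexx ler01 lo_hi.
have dS n k : sdist (S n.+1 k).1 (S n k).1 <= 2 ^- n /\
    sdist (S n.+1 k).2 (S n k).2 <= 2 ^- n.
  elim: n k => [|n IH] k.
    rewrite expr0 invr1; have [x1 /reg01 y1] := VS 1%N k.
    have [x0 /reg01 y0] := VS 0%N k.
    by split; exact: sdist_le1.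
  have half : 2 ^- n / 2 = 2 ^- n.+1 :> R by rewrite exprS invfM mulrC.
  by rewrite -half; exact: (cnext _ _ _ (VS n.+1) (VS n)).
(* The limits are taken in square-root coordinates, where the iterates form geometric Cauchy
   sequences, and are squared afterwards. *)
have [lx Hx] := choice (fun k => geometric_limit (u := fun n => Num.sqrt (S n k).1)
  (fun n => (dS n k).1)).
have [ly Hy] := choice (fun k => geometric_limit (u := fun n => Num.sqrt (S n k).2)
  (fun n => (dS n k).2)).
have lim_itv (u : nat -> R) l a c : 0 <= a -> a <= c -> (forall n, a <= u n <= c) ->
    (forall n, `|Num.sqrt (u n) - l| <= 2 * 2 ^- n) -> 0 <= l /\ a <= l ^+ 2 <= c.
  move=> a0 ac uac ul; have c0 := le_trans a0 ac.
  have al : Num.sqrt a <= l.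
    apply: (@le_of_geometric _ _ _ 2) => n.
    have /andP[/ler_wsqrtr + _] := uac n; have := ul n; rewrite ler_norml; lra.
  have lc : l <= Num.sqrt c.
    apply: (@le_of_geometric _ _ _ 2) => n.
    have /andP[_ /ler_wsqrtr +] := uac n; have := ul n; rewrite ler_norml; lra.
  have l0 : 0 <= l := le_trans (sqrtr_ge0 a) al.
  split => //; apply/andP; split.
    by rewrite -[leLHS]sqr_sqrtr// ler_pXn2r ?nnegrE ?sqrtr_ge0.
  by rewrite -[leRHS]sqr_sqrtr// ler_pXn2r ?nnegrE ?sqrtr_ge0.
pose p k := (lx k ^+ 2, ly k ^+ 2).
have Lx k : 0 <= lx k /\ 0 <= lx k ^+ 2 <= 1.
  by apply: (lim_itv (fun n => (S n k).1)) => // n; case: (VS n k).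
have Ly k : 0 <= ly k /\ reg (xi k) (ly k ^+ 2).
  by apply: (lim_itv (fun n => (S n k).2)) => // n; case: (VS n k).
have Vp : V p by move=> k; split; [case: (Lx k)|case: (Ly k)].
have Sp n k : sdist (S n k).1 (p k).1 <= 2 * 2 ^- n /\ sdist (S n k).2 (p k).2 <= 2 * 2 ^- n.
  rewrite /sdist /p /= !sqrtr_sqr.
  by rewrite (ger0_norm (Lx k).1) (ger0_norm (Ly k).1); split.
(* [next] contracts the supremum distance, so S n.+1 is close to both [next p] and p. *)
have fixp k : next p k = p k.
  have D n : sdist (next p k).1 (p k).1 <= 0 + 2 * 2 ^- n /\
      sdist (next p k).2 (p k).2 <= 0 + 2 * 2 ^- n.
    have half : 2 * 2 ^- n.+1 = 2 ^- n :> R.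
      by rewrite exprS invfM mulrA divff ?mul1r// pnatr_eq0.
    have [a b'] := cnext _ _ _ (VS n) Vp (Sp n) k.
    have [a' b''] := Sp n.+1 k; rewrite half in a' b''.
    split.
      apply: (le_trans (sdist_trans (S n.+1 k).1 _ _)).
      by rewrite [X in X + _ <= _]sdistC; move: a a'; rewrite -[next (S n) k]/(S n.+1 k); lra.
    apply: (le_trans (sdist_trans (S n.+1 k).2 _ _)).
    by rewrite [X in X + _ <= _]sdistC; move: b' b''; rewrite -[next (S n) k]/(S n.+1 k); lra.
  have [/andP[n1 _] /reg01/andP[n2 _]] := Vnext _ Vp k.
  have [/andP[p1 _] /reg01/andP[p2 _]] := Vp k.
  apply: injective_projections; apply: sdist_eq0 => //;
  by apply: (@le_of_geometric _ _ _ 2) => n; case: (D n).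
exists p => k; have [x01 r] := Vp k; split => //.
have Ek := fixp k; have Ek1 := fixp (k + 1).
have [_ E _] := BX p k Vp.
have Bp : B p k = (p k).2 by rewrite -[in RHS]Ek.
apply: injective_projections.
  rewrite -[in RHS]Ek1 /next /= addrK /X Bp; congr (f _).1.
rewrite -E Bp; congr (f _).2.
Qed.

End Symbolic.

(** * Vertical expansion for all small parameters *)

Section Transfer.
Context {R : realType} {c q : R} {Psi : R * R -> R * R}.
Context {lam0 sig0 t0 b30 t30 : R} {psi10 psi20 : R -> R} {f0 : R * R -> R * R}.
Hypothesis H0 : horseshoe lam0 sig0 c q t0 b30 t30 psi10 psi20 Psi f0.
Context {lam sig t b3 t3 : R} {psi1 psi2 : R -> R} {f : R * R -> R * R}.
Hypothesis H : horseshoe lam sig c q t b3 t3 psi1 psi2 Psi f.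
Implicit Types x y : R.

Hypothesis lam_le : lam <= lam0.
Hypothesis narrow : sig^-1 + lam <= sig0^-1.
Hypothesis flat : 4 * c * (sig^-1 + lam) <= 1.

Local Notation X x y := (f (x, y)).1.
Local Notation Y x y := (f (x, y)).2.

(* The map Gamma of f at (x, y) agrees with the map Gamma of f0 at
   (lam / lam0 * x, rescale y). *)
Let rescale y := t0 + sig * (y - t) / sig0.

(** The matched points have the same value under Gamma and Psi is shared, so the images agree once
    the matched point is known to lie in the region R4 of f0. *)
Lemma fold_rescale x y : R4 psi1 psi2 (x, y) -> Y x y <= sig^-1 ->
  R4 psi10 psi20 (lam / lam0 * x, rescale y) /\
  f (x, y) = f0 (lam / lam0 * x, rescale y).
Proof.
move=> in4 low.
have [l0 s0 i0 _ _] := parameter_bounds H.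
have [l00 s00 i00 _ _] := parameter_bounds H0.
have [xi yi] := (R4_itv H x y).1 in4.
have x0i : 0 <= lam / lam0 * x <= 1.
  have k0 : 0 <= lam / lam0 by rewrite divr_ge0 ?ltW.
  have k1 : lam / lam0 <= 1 by rewrite ler_pdivrMr// mul1r.
  rewrite mulr_ge0//=; last by case/andP: xi.
  by rewrite mulr_ile1//; case/andP: xi.
have lamE : lam0 * (lam / lam0 * x) = lam * x by field; rewrite gt_eqF.
have same z : R4 psi1 psi2 (x, z) -> R4 psi10 psi20 (lam / lam0 * x, rescale z) ->
    f (x, z) = f0 (lam / lam0 * x, rescale z).
  move=> iz iz0; rewrite (hs_Psi H)// (hs_Psi H0)// lamE; congr (Psi (_, _)).
  by rewrite /rescale; field; rewrite gt_eqF.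
(* A point leaving the region R4 of f0 would have passed through its boundary,
   whose image is higher. *)
have high z : t <= z <= y \/ y <= z <= t -> R4 psi10 psi20 (lam / lam0 * x, rescale z) ->
    sig0^-1 < (f0 (lam / lam0 * x, rescale z)).2 -> False.
  move=> zi iz0; have [iz D _] := fold_side H in4 zi.
  rewrite -(same _ iz iz0) (Y_graph H iz).
  have := Y_graph H in4; have := ler_wpM2l (ltW (hs_c H)) D; have := narrow; lra.
(* The inverse of [rescale]. *)
pose g w := t + sig0 * (w - t0) / sig.
have back w : rescale (g w) = w.
  by rewrite /rescale /g; field; rewrite !gt_eqF.
have gy : g (rescale y) = y by rewrite /rescale /g; field; rewrite !gt_eqF.
have gt0 : g t0 = t by rewrite /g subrr mulr0 mul0r addr0.
have gmono w w' : w <= w' -> g w <= g w'.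
  move=> ww; rewrite /g lerD2l ler_wpM2r ?invr_ge0 ?(ltW s0)//.
  by rewrite ler_wpM2l ?(ltW s00)// lerD2r.
have [tin _] := fold_tip H0 x0i; have [_ /andP[t1 t2]] := tin.
have [[[_ /= /andP[s1 _]] _] [[_ /= /andP[s2 _]] _]] := hs_R4_sides H0 x0i.
have [p1 p12 p2] := hs_strip4 H0 x0i.
suff in40 : R4 psi10 psi20 (lam / lam0 * x, rescale y) by split => //; exact: same.
apply/(R4_itv H0); split => //; apply/andP; split; rewrite leNgt; apply/negP => out.
- apply: (high (g (psi10 (lam / lam0 * x)))); rewrite ?back//; last first.
    by apply/(R4_itv H0); split => //; rewrite lexx ltW.
  by have := gmono _ _ (ltW out); have := gmono _ _ (ltW t1); rewrite gy gt0 => -> ->; right.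
- apply: (high (g (psi20 (lam / lam0 * x)))); rewrite ?back//; last first.
    by apply/(R4_itv H0); split => //; rewrite lexx ltW.
  by have := gmono _ _ (ltW out); have := gmono _ _ (ltW t2); rewrite gy gt0 => -> ->; left.
Qed.

(** The expansion of f0 by sig0 / 2 becomes sig / 2, as [rescale] multiplies distances by sig /
    sig0. The hypothesis [flat] ensures s^2 <= 1, because s^2 = 4 c (Y + lam x). *)
Lemma fold_expand x y y' : R4 psi1 psi2 (x, y) -> R4 psi1 psi2 (x, y') ->
  Y x y <= sig^-1 -> Y x y' <= sig^-1 -> sig / 2 * `|y - y'| <= `|X x y - X x y'|.
Proof.
move=> i i' l l'.
have [_ s0 _ _ _] := parameter_bounds H; have [l0 _ _ _ _] := parameter_bounds H.
have [_ s00 _ _ _] := parameter_bounds H0.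
have [xi _] := (R4_itv H x y).1 i; have [x0 x1] := andP xi.
have narrow_image v : R4 psi1 psi2 (x, v) -> Y x v <= sig^-1 ->
    c * (X x v - q) ^+ 2 <= sig0^-1 /\ (2 * c * (X x v - q)) ^+ 2 <= 1.
  move=> iv lv; have K : c * (X x v - q) ^+ 2 <= sig^-1 + lam.
    have := Y_graph H iv; have := ler_wpM2l (ltW l0) x1; lra.
  split; first exact: le_trans K narrow.
  apply: le_trans flat; rewrite (_ : _ ^+ 2 = 4 * c * (c * (X x v - q) ^+ 2)); last by ring.
  by rewrite ler_wpM2l// mulr_ge0// ltW// (hs_c H).
have [n1 n2] := narrow_image _ i l; have [n1' n2'] := narrow_image _ i' l'.
have [i0 E] := fold_rescale i l; have [i0' E'] := fold_rescale i' l'.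
rewrite E in n1 n2 *; rewrite E' in n1' n2' *.
apply: le_trans (fold_expand_self H0 i0 i0' n1 n1' n2 n2').
rewrite (_ : rescale y - rescale y' = sig / sig0 * (y - y')); last first.
  by rewrite /rescale; field; rewrite gt_eqF.
rewrite normrM ger0_norm ?divr_ge0 ?(ltW s0) ?(ltW s00)//.
by rewrite (_ : sig0 / 2 * _ = sig / 2 * `|y - y'|)//; field; rewrite gt_eqF.
Qed.

End Transfer.

(** * The coding *)

Lemma lt_int_addn (a b : int) : a < b -> exists n : nat, b = a + 1 + n%:Z.
Proof. by move=> ab; exists (absz (b - (a + 1))%R); lia. Qed.

Section Semiconjugacy.
Context {R : realType} {lam sig c q t b3 t3 : R} {psi1 psi2 : R -> R}
  {Psi f : R * R -> R * R}.
Implicit Types (x y : R) (k : int) (xi : int -> 'I_3) (p : int -> R * R).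
Hypothesis H : horseshoe lam sig c q t b3 t3 psi1 psi2 Psi f.

Local Notation reg := (reg sig b3 t).
Local Notation lo := (reg_lo b3 t).
Local Notation hi := (reg_hi sig t).

Hypothesis solve : forall x i j Y0, 0 <= x <= 1 -> reg j Y0 ->
  exists y, [/\ reg i y, (f (x, y)).2 = Y0 & 0 <= (f (x, y)).1 <= 1].
Hypothesis contract : forall x y x' y' i j (M : R),
  0 <= x <= 1 -> 0 <= x' <= 1 -> reg i y -> reg i y' ->
  reg j (f (x, y)).2 -> reg j (f (x', y')).2 ->
  sdist x x' <= M -> sdist (f (x, y)).2 (f (x', y')).2 <= M ->
  sdist (f (x, y)).1 (f (x', y')).1 <= M / 2 /\ sdist y y' <= M / 2.

Let lo_ge0 i : 0 <= lo i.
Proof.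
have [l0 s0 i0 i3 [b1 b2 b4 b5 b6]] := parameter_bounds H.
by rewrite /reg_lo; case: (val i) => [|[|?]]; lra.
Qed.
Let lo_hi i : lo i <= hi i.
Proof.
have [l0 s0 i0 i3 [b1 b2 b4 b5 b6]] := parameter_bounds H.
by rewrite /reg_lo /reg_hi; case: (val i) => [|[|?]]; lra.
Qed.
Let hi_le1 i : hi i <= 1.
Proof.
have [l0 s0 i0 i3 [b1 b2 b4 b5 b6]] := parameter_bounds H.
by rewrite /reg_hi; case: (val i) => [|[|?]]; lra.
Qed.

Local Notation follows := (@follows R 'I_3 lo hi f).

Let square_itv (z : R * R) : square z <-> 0 <= z.1 <= 1 /\ 0 <= z.2 <= 1.
Proof. by case: z => x y; rewrite /square/= !in_itv. Qed.

Lemma follows_square xi p k : follows xi p -> square (p k).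
Proof.
move=> /(_ k)[x01 r _]; apply/square_itv; split=> //; exact: (reg_itv H (i := xi k) r).
Qed.

Lemma follows_iter xi p k n : follows xi p -> iter n f (p k) = p (k + n%:Z).
Proof.
move=> P; elim: n => [|n IH] /=; first by rewrite addr0.
by rewrite IH; have [_ _ ->] := P (k + n%:Z); congr p; lia.
Qed.

Lemma follows_same_point xi xi' p p' : follows xi p -> follows xi' p' ->
  p 0 = p' 0 -> p = p'.
Proof.
move=> P P' E; apply/funext => -[n|n].
  have := follows_iter 0 n P; have := follows_iter 0 n P'.
  by rewrite !add0r => <- <-; rewrite E.
have iter_inj m : injective (iter m f).
  by elim: m => [|m IH] a b //= /(hs_inj H) /IH.
apply: (iter_inj n.+1); rewrite (follows_iter _ _ P) (follows_iter _ _ P').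
by rewrite NegzE addNr.
Qed.

Lemma follows_Lambda xi p : follows xi p -> Lambda f (p 0).
Proof.
move=> P; split=> n _ /=.
  exists (p (- n%:Z)); first exact: follows_square P.
  by rewrite (follows_iter _ _ P) addNr.
by rewrite (follows_iter _ _ P); exact: follows_square P.
Qed.

Lemma Lambda_follows z : Lambda f z -> exists xi p, follows xi p /\ p 0 = z.
Proof.
move=> [past future]; have [_ [g [_ fg gf]]] := hs_diffeo H.
pose p k := match k with Posz n => iter n f z | Negz n => iter n.+1 g z end.
have sq k : square (p k).
  case: k => n /=; first exact: future.
  have [w sqw <-] := past n.+1 I.
  have can m : iter m g (iter m f w) = w.
    by elim: m => //= m IH; rewrite -iterS iterSr fg.
  by rewrite -iterS can.
have step k : f (p k) = p (k + 1).
  case: k => [n|[|n]]; first by rewrite (_ : Posz n + 1 = Posz n.+1)//; lia.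
    by rewrite (_ : Negz 0 + 1 = 0)//= gf.
  by rewrite (_ : Negz n.+1 + 1 = Negz n) /= ?gf//; lia.
have /choice[xi Hxi] : forall k, exists i, reg i (p k).2.
  move=> k; have [x01 y01] := (square_itv (p k)).1 (sq k).
  have := sq (k + 1); rewrite -step.
  by move: x01 y01; case: (p k) => x y /= x01 y01; exact: (reg_exists H x01 y01).
exists xi, p; split => // k; split => //; first by have [] := (square_itv (p k)).1 (sq k).
exact: Hxi.
Qed.

(** Two regions meet only on y = t, where Y = - lam x; an image in the square then forces x = 0. *)
Lemma reg_overlap x y i j : 0 <= x <= 1 -> square (f (x, y)) ->
  reg i y -> reg j y -> i != j -> x = 0 /\ y = t.
Proof.
move=> x01 sq ri rj ij.
have [l0 s0 i0 i3 [b1 b2 b4 b5 b6]] := parameter_bounds H.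
have yt : y = t.
  move: ri rj ij; rewrite -val_eqE /reg /reg_lo /reg_hi /=.
  by case: i => -[|[|[|//]]] ? /=; case: j => -[|[|[|//]]] ? //= ? ? _; lra.
split => //; rewrite yt in sq; have [tin tq] := fold_tip H x01.
have [_ /andP[+ _]] := (square_itv _).1 sq.
rewrite (Y_graph H (inside_R4 H tin)) tq subrr expr0n /= mulr0 sub0r oppr_ge0.
by rewrite pmulr_rle0//; move: x01; lra.
Qed.

(* After (0, t), the orbit stays on the side y = 0 and has x > 0. *)
Lemma tangency_once xi p k k' : follows xi p -> p k = (0, t) -> p k' = (0, t) -> k = k'.
Proof.
move=> P.
have [l0 s0 i0 i3 [b1 b2 b4 b5 b6]] := parameter_bounds H.
have q0 : 0 < q by have := hs_q H; lra.
have never a n : p a = (0, t) -> p (a + 1 + n%:Z) = (lam ^+ n * q, 0).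
  move=> pa; rewrite -(follows_iter _ _ P); have [_ _ <-] := P a.
  rewrite pa (hs_T H).2; elim: n => [|n IH]; first by rewrite expr0 mul1r.
  rewrite iterS IH.
  have sqx : 0 <= lam ^+ n * q <= 1.
    have := follows_square (a + 1 + n%:Z) P.
    rewrite -(follows_iter _ _ P); have [_ _ <-] := P a.
    by rewrite pa (hs_T H).2 IH => /square_itv[].
  have y0 : 0 <= (0 : R) <= sig^-1 by rewrite lexx ltW.
  have [E1 E2] := R1_map H sqx y0.
  by apply: injective_projections; rewrite ?E1 ?E2 /= ?mulr0// exprS mulrA.
have lt_absurd a b : p a = (0, t) -> p b = (0, t) -> a < b -> False.
  move=> pa pb ab; have [n En] := lt_int_addn ab.
  have := never a n pa; rewrite -En pb => -[E _].
  by have := mulr_gt0 (exprn_gt0 n l0) q0; rewrite -E ltxx.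
move=> pk pk'; case: (ltrgtP k k') => // kk.
  by case: (lt_absurd k k').
by case: (lt_absurd k' k).
Qed.

Lemma horseshoe_coding : exists Theta : Sigma3 -> R * R,
  [/\ semiconjugacy f Theta, finite_to_one Theta & hoelder_continuous Theta].
Proof.
have /choice[P HP] := follows_exists lo_ge0 lo_hi hi_le1 solve contract.
pose Theta xi := P xi 0.
have ThetaE xi p : follows xi p -> Theta xi = p 0.
  by move=> Pp; apply: (follows_unique lo_ge0 hi_le1 contract (HP xi) Pp).
exists Theta; split.
- split=> [xi|z Lz|xi].
  + exact: follows_Lambda (HP xi).
  + have [xi [p [Pxi <-]]] := Lambda_follows Lz.
    by exists xi; exact: ThetaE.
  + have [_ _ E] := HP xi 0; rewrite /Theta E.
    by apply: (ThetaE (shift3 xi) (fun k => P xi (k + 1))) => k; exact: HP.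
- move=> z; have [[xi0 z0]|none] := pselect (exists xi, Theta xi = z); last first.
    rewrite (_ : Theta @^-1` [set z] = set0); first exact: finite_set0.
    by apply/seteqP; split => // xi Exi; apply: none; exists xi.
  have [k0 Hk0] : exists k0, forall k, k != k0 -> P xi0 k <> (0, t).
    have [[k0 pk0]|no] := pselect (exists k0, P xi0 k0 = (0, t)).
      exists k0 => k kk0 pk; move/eqP: kk0; apply.
      exact: tangency_once (HP xi0) pk pk0.
    by exists 0 => k _ pk; apply: no; exists k.
  (* All codes of z follow the same orbit and can differ only at the time k0 of the tangency, so
     there are at most three. *)
  pose upd (i : 'I_3) : Sigma3 := fun k => if k == k0 then i else xi0 k.
  apply: (@sub_finite_set _ _ (upd @` setT)); last exact/finite_image/finite_finset.
  move=> xi /= Exi; exists (xi k0) => //; apply/funext => k; rewrite /upd.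
  have [->//|kk0] := eqVneq k k0.
  have PE : P xi = P xi0.
    by apply: follows_same_point (HP xi) (HP xi0) _; rewrite -/(Theta xi) Exi -z0.
  apply/eqP/negPn/negP => ne; apply: (Hk0 k kk0).
  have [x01 r E] := HP xi0 k; have [_ r' _] := HP xi k; rewrite PE in r'.
  have sq := follows_square (k + 1) (HP xi0); rewrite -E in sq.
  move: x01 r r' sq; case: (P xi0 k) => x y /= x01 r r' sq.
  by have [-> ->] := reg_overlap x01 sq r r' ne.
(* Agreement on [- n, n] gives 2 * 2 ^- n in square-root coordinates, hence 4 * 2 ^- n for each
   coordinate and 8 * 2 ^- n for the norm. *)
- exists 8, 1; split; [by []|by rewrite ltr01 lexx|].
  move=> xi xi'.
  have d0 : 0 <= dist3 xi xi' :> R by rewrite /dist3; case: pselect.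
  rewrite powRr1//.
  have [x1 y1] := (square_itv (P xi 0)).1 (follows_square 0 (HP xi)).
  have [x1' y1'] := (square_itv (P xi' 0)).1 (follows_square 0 (HP xi')).
  have enorm_le (v : R * R) : enorm v <= `|v.1| + `|v.2|.
    rewrite /enorm -[leRHS]ger0_norm ?addr_ge0// -sqrtr_sqr ler_wsqrtr//.
    rewrite sqrrD !real_normK ?num_real// lerD2r lerDl mulrn_wge0// mulr_ge0//.
  have [ex|no] := pselect (exists n, differ_at xi xi' n); last first.
    have E : xi = xi'.
      apply/funext => k; apply/eqP/negPn/negP => ne; apply: no; exists (absz k).
      rewrite /differ_at; case: k ne => n ne /=; first by rewrite ne.
      by rewrite orbC NegzE in ne *; rewrite ne.
    rewrite E in d0 *; rewrite subrr /enorm /= expr0n addr0 sqrtr0.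
    exact: mulr_ge0.
  have bound (D : R) : `|(P xi 0).1 - (P xi' 0).1| <= 4 * D ->
      `|(P xi 0).2 - (P xi' 0).2| <= 4 * D -> D <= dist3 xi xi' ->
      enorm (Theta xi - Theta xi') <= 8 * dist3 xi xi'.
    by move=> a b DD; apply: le_trans (enorm_le _) _; rewrite /=; lra.
  move: bound; rewrite /dist3; case: pselect => // ex'.
  case: ex_minnP => -[|n] diff minn bound.
    (* The symbols differ at time 0, so the distance of the codes is 2, and the coordinates of both
       points lie in [0, 1]. *)
    apply: (bound (1 / 2)); rewrite ?expr0 ?ler_norml; lra.
  have agree k : - n%:Z <= k <= n%:Z -> xi k = xi' k.
    move=> kn; apply/eqP/negPn/negP => ne.
    have : differ_at xi xi' (absz k).
      rewrite /differ_at; case: k ne {kn} => m ne /=; first by rewrite ne.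
      by rewrite orbC NegzE in ne *; rewrite ne.
    by move/minn; lia.
  have [a b] := follows_close lo_ge0 hi_le1 contract (HP xi) (HP xi') agree.
  have half : 2 * 2 ^- n.+1 = 2 ^- n :> R.
    by rewrite exprS invfM mulrA divff ?mul1r// pnatr_eq0.
  apply: (bound (2 ^- n)); rewrite ?half//.
    by apply: le_trans (dist_le_sdist x1 x1') _; lra.
  by apply: le_trans (dist_le_sdist y1 y1') _; lra.
Qed.

End Semiconjugacy.

(** * Choice of the constants *)

Unset Implicit Arguments.
Set Strict Implicit.

Theorem proposition6p2 (R : realType) :
  exists c0 : R, 0 < c0 /\
  forall c : R, c0 <= c ->
  forall (b q : R) (Psi : R * R -> R * R), 0 < b ->
  exists eps : R, 0 < eps /\
  forall (lam sig t b3 t3 : R) (psi1 psi2 : R -> R) (f : R * R -> R * R),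
    horseshoe lam sig c q t b3 t3 psi1 psi2 Psi f ->
    lam < eps -> sig^-1 < eps ->
    2 * Num.sqrt (c * (lam + sig^-1)) < atan (pi / 10) ->
    0 < b^-1 -> b^-1 < - ln lam / ln sig -> - ln lam / ln sig < b ->
  exists Theta : Sigma3 -> R * R,
    [/\ semiconjugacy f Theta, finite_to_one Theta & hoelder_continuous Theta].
Proof.
exists 16; split=> // c c16 b q Psi _.
(* The expansion is carried over from one reference map with the same c, q and Psi. If there is
   none, any eps will do, and 1 is taken. *)
pose has_map := exists (lam sig t b3 t3 : R) (psi1 psi2 : R -> R) (f : R * R -> R * R),
  horseshoe lam sig c q t b3 t3 psi1 psi2 Psi f.
have [[lam0 [sig0 [t0 [b30 [t30 [psi10 [psi20 [f0 H0]]]]]]]]|none] := pselect has_map; last first.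
  exists 1; split=> // lam sig t b3 t3 psi1 psi2 f Hf; case: none.
  by exists lam, sig, t, b3, t3, psi1, psi2, f.
have [l00 s00 i00 _ _] := parameter_bounds H0.
have q1 : 0 < 1 - q by have := hs_q H0; lra.
have c0 : 0 < c by lra.
pose m := Num.min (1 / 3) (1 - q).
have m0 : 0 < m by rewrite lt_min q1 divr_gt0.
(* The terms serve in turn for the contraction of the affine branches, for the comparison with the
   reference map ([lam0] and [sig0^-1 / 2]), for [flat], and for the low images of the fold to stay
   within m of q. *)
exists (Num.min (1 / 16) (Num.min lam0 (Num.min (sig0^-1 / 2)
  (Num.min (8 * c)^-1 (c * m ^+ 2 / 2))))).
split; first by rewrite !lt_min l00 !divr_gt0 ?invr_gt0 ?mulr_gt0 ?exprn_gt0.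
move=> lam sig t b3 t3 psi1 psi2 f Hf.
rewrite !lt_min => /and5P[l1 l2 l3 l4 l5] /and5P[k1 k2 k3 k4 k5] _ _ _ _.
have flat : 4 * c * (sig^-1 + lam) <= 1.
  have : 4 * c * (sig^-1 + lam) <= 4 * c * ((8 * c)^-1 + (8 * c)^-1).
    by rewrite ler_pM2l ?mulr_gt0//; lra.
  have -> // : 4 * c * ((8 * c)^-1 + (8 * c)^-1) = 1.
  by field; rewrite gt_eqF.
have narrow : sig^-1 + lam <= sig0^-1 by lra.
have expand := fold_expand H0 Hf (ltW l2) narrow flat.
have lam16 := ltW l1; have isig16 := ltW k1.
have m3 : m <= 1 / 3 by rewrite ge_min lexx.
have mq : m <= 1 - q by rewrite ge_min lexx orbT.
have nar : sig^-1 + lam <= c * m ^+ 2 by lra.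
apply: (horseshoe_coding Hf).
- exact: (step_solve Hf lam16 m0 m3 mq nar).
- exact: (step_contract Hf c16 lam16 isig16 m0 m3 mq nar expand).
Qed.
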